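(* Let $\mathcal{C}$ be an effectively compact, effectively orthogonal class of probability measures on a constructive metric space $X$. Let $\mathbf{t}_{\mathcal{C}}(x)$ be a universal $\mathcal{C}$-test, $s(x,P)$ a test-separator for $\mathcal{C}$, and $\mathbf{t}(x,P)$ a universal uniform test. Then $\mathbf{t}(x,P)\doteq\max(\mathbf{t}_{\mathcal{C}}(x),s(x,P))$ for all $P\in\mathcal{C}$ and all $x\in X$, i.e. the two sides are within bounded multiplicative constants of each other.
   Context: A constructive metric space $(X,d,D,\alpha)$ is a complete separable metric space with a numbered dense countable set $D$ on which $d$ is uniformly computable; basic balls have centres in $D$ and rational radii. $\mathcal{M}(X)$ (probability measures, Prokhorov metric, dense set of rational finitely supported measures on $D$) is a constructive metric space; $\mathcal{C}\subseteq\mathcal{M}(X)$ is effectively compact if compact and its finite coverings by basic balls form an enumerable set. Lower semicomputable functions (on $X$ or on $X\times\mathcal{M}(X)$) into $[0,\infty]$: each superlevel set $\{f>r\}$, $r$ rational, is a union of an enumerable family of basic balls (resp. products of basic balls), uniformly in $r$. A $\mathcal{C}$-test is a lower semicomputable $t:X\to[0,\infty]$ with $\int t\,dP\le1$ for all $P\in\mathcal{C}$; a uniform test is a lower semicomputable $t(x,P)\ge0$ with $\int t(x,P)\,dP(x)\le1$ for all $P\in\mathcal{M}(X)$; universal means maximal up to a multiplicative constant. $\mathrm{Randoms}(P)=\{x:\mathbf{t}(x,P)<\infty\}$; $\mathcal{C}$ is effectively orthogonal if $\mathrm{Randoms}(P)\cap\mathrm{Randoms}(Q)=\varnothing$ for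 distinct $P,Q\in\mathcal{C}$. A test-separator for $\mathcal{C}$ is a lower semicomputable $s:X\times\mathcal{M}(X)\to[0,\infty]$ with $\int s(x,P)\,dP(x)\le1$ for all $P$ such that for all distinct $P,Q\in\mathcal{C}$ and every $x$ at least one of $s(x,P),s(x,Q)$ is infinite. *)

(* Defs.v *)
From HB Require Import structures.
From mathcomp Require Import all_boot all_order all_algebra.
From mathcomp Require Import all_classical all_reals all_analysis.

Set Implicit Arguments.
Unset Strict Implicit.
Unset Printing Implicit Defensive.
Import Order.TTheory GRing.Theory Num.Theory.
Import numFieldNormedType.Exports.

Local Open Scope classical_set_scope.
Local Open Scope ring_scope.

(* Kleene's total recursive functions; minimisation is applied only to regular
   functions, i.e. when the search succeeds at every argument. *)
Inductive recursive : forall n, (n.-tuple nat -> nat) -> Prop :=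
| recursive_zero n : recursive (fun _ : n.-tuple nat => 0%N)
| recursive_succ : recursive (fun v : 1.-tuple nat => (thead v).+1)
| recursive_proj n (i : 'I_n) : recursive (fun v : n.-tuple nat => tnth v i)
| recursive_comp m n (f : m.-tuple nat -> nat)
    (g : 'I_m -> n.-tuple nat -> nat) :
    recursive f -> (forall i, recursive (g i)) ->
    recursive (fun v : n.-tuple nat => f [tuple g i v | i < m])
| recursive_prec n (f : n.-tuple nat -> nat) (g : n.+2.-tuple nat -> nat) :
    recursive f -> recursive g ->
    recursive (fun v : n.+1.-tuple nat =>
      nat_rect (fun=> nat) (f (behead_tuple v))
        (fun k y => g (cons_tuple k (cons_tuple y (behead_tuple v))))
        (thead v))
| recursive_mu n (f : n.+1.-tuple nat -> nat) (h : n.-tuple nat -> nat) :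
    recursive f ->
    (forall v, f (cons_tuple (h v) v) = 0%N) ->
    (forall v k, (k < h v)%N -> f (cons_tuple k v) <> 0%N) ->
    recursive h.

(* The algorithm f outputs at stage k the element with code (f k).-1, or nothing
   if f k = 0.  This is used only for types I built from nat by products and
   lists, on which [pickle] is an effective coding: the identity on nat, and
   [CodeSeq.code] of the codes of the components for pairs and lists. *)
Definition enumerable (I : countType) (E : set I) : Prop :=
  exists2 f : nat -> nat, recursive (fun v : 1.-tuple nat => f (thead v)) &
    forall i, E i <-> exists k, f k = (pickle i).+1.

HB.mixin Record isConstructiveMetric (R : realType) X
    & Metric R X & CompletePseudoMetric R X := {
  ideal_point : nat -> X ;
  ideal_point_dense : dense (range ideal_point) ;
  ideal_point_computable : exists2 f : 3.-tuple nat -> nat, recursive f &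
    forall i j n,
      `|mdist (ideal_point i) (ideal_point j) - (f [tuple i; j; n])%:R / 2 ^+ n|
        <= 2 ^- n :> R
}.

#[short(type="constructiveMetricType")]
HB.structure Definition ConstructiveMetric (R : realType) :=
  {X of Metric R X & CompletePseudoMetric R X & isConstructiveMetric R X}.

Section rational_names.
Variable R : realType.

Definition rat_name := (nat * nat * nat)%type.
Definition rat_of (q : rat_name) : R := (q.1.1%:R - q.1.2%:R) / q.2.+1%:R.

Definition posrat_name := (nat * nat)%type.
Definition posrat_of (q : posrat_name) : R := q.1.+1%:R / q.2.+1%:R.

End rational_names.

Definition borel (R : realType) (X : constructiveMetricType R) :=
  g_sigma_algebraType (@open X).

(* Elements of [probability] are functions on all subsets, so measures that agree
   on Borel sets may still differ for Leibniz equality; [same_measure] is the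
   intended equality and the Prokhorov distance is a metric up to it. *)
Definition measures (R : realType) (X : constructiveMetricType R) :=
  probability (borel X) R.

Definition same_measure (R : realType) (X : constructiveMetricType R)
    (P Q : measures X) : Prop :=
  forall A : set (borel X), measurable A -> P A = Q A.

Section prokhorov.
Variables (R : realType) (X : constructiveMetricType R).
Implicit Types (P Q : measures X) (A : set X) (e : R).

Definition enlargement A e : set X := \bigcup_(x in A) ball x e.

Definition prokhorov_close P Q e : Prop :=
  0 < e /\ forall A : set (borel X), measurable A ->
    (P A <= Q (enlargement A e) + e%:E /\ Q A <= P (enlargement A e) + e%:E)%E.

Definition prokhorov P Q : R := inf [set e | prokhorov_close P Q e].

End prokhorov.

Section prokhorov_theory.
Variables (R : realType) (X : constructiveMetricType R).
Implicit Types (P Q : measures X) (A : set X) (e : R).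

Lemma enlargement_measurable A e :
  0 < e -> measurable (enlargement A e : set (borel X)).
Proof.
move=> e0; apply: sub_sigma_algebra.
rewrite /enlargement; apply: bigcup_open => x _.
rewrite openE => y; rewrite ballEmdist /= => xy.
apply/nbhs_ballP; exists (e - mdist x y); first by rewrite /= subr_gt0.
move=> z; rewrite !ballEmdist /= ltrBrDl; apply: le_lt_trans.
exact: metric_triangle.
Qed.

Lemma sub_enlargement A e : 0 < e -> A `<=` enlargement A e.
Proof. by move=> e0 x Ax; exists x => //; exact: ballxx. Qed.

Lemma enlargementD A e1 e2 :
  enlargement (enlargement A e1) e2 `<=` enlargement A (e1 + e2).
Proof.
by move=> z [y [x Ax xy] yz]; exists x => //; exact: ball_triangle xy yz.
Qed.

Lemma prokhorov_close1 P Q : prokhorov_close P Q 1.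
Proof.
split=> // A mA; have mA1 := enlargement_measurable A (@ltr01 R).
by split; rewrite (le_trans (probability_le1 _ mA))// leeDr.
Qed.

Lemma prokhorov_closexx P e : 0 < e -> prokhorov_close P P e.
Proof.
move=> e0; split=> // A mA; have mAe := enlargement_measurable A e0.
have le : (P A <= P (enlargement A e) + e%:E)%E.
  apply: (@le_trans _ _ (P (enlargement A e))).
    by apply: le_measure; rewrite ?inE//; exact: sub_enlargement.
  by rewrite leeDl// lee_fin ltW.
by split.
Qed.

Lemma prokhorov_close_sym P Q e : prokhorov_close P Q e -> prokhorov_close Q P e.
Proof. by move=> [e0 H]; split=> // A mA; have [] := H _ mA. Qed.

Lemma prokhorov_close_trans P Q S e1 e2 : prokhorov_close P Q e1 ->
  prokhorov_close Q S e2 -> prokhorov_close P S (e1 + e2).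
Proof.
suff half P' Q' S' d1 d2 : prokhorov_close P' Q' d1 -> prokhorov_close Q' S' d2 ->
    forall A : set (borel X), measurable A ->
    (P' A <= S' (enlargement A (d1 + d2)) + (d1 + d2)%:E)%E.
  move=> PQ QS; split=> [|A mA]; first by rewrite addr_gt0// ?PQ.1 ?QS.1.
  split; first exact: half PQ QS _ mA.
  rewrite (addrC e1).
  exact: half (prokhorov_close_sym QS) (prokhorov_close_sym PQ) _ mA.
move=> [d10 PQ] [d20 QS] A mA; have [PA _] := PQ _ mA.
have mA1 := enlargement_measurable A d10; have [QA _] := QS _ mA1.
apply: (le_trans PA); rewrite EFinD addeA (addeAC _ d1%:E) leeD2r//.
apply: (le_trans QA); rewrite leeD2r//; apply: le_measure; rewrite ?inE.
- exact: enlargement_measurable.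
- by apply: enlargement_measurable; rewrite addr_gt0.
- exact: enlargementD.
Qed.

Lemma prokhorov_has_inf P Q : has_inf [set e | prokhorov_close P Q e].
Proof.
split; first by exists 1; exact: prokhorov_close1.
by exists 0 => e [/ltW].
Qed.

Lemma prokhorov_ltP P Q e :
  prokhorov P Q < e <-> exists2 d, prokhorov_close P Q d & d < e.
Proof.
split=> [PQe|[d PQd de]].
  have := inf_adherent _ (prokhorov_has_inf P Q).
  move=> /(_ (e - prokhorov P Q)); rewrite subr_gt0 => /(_ PQe)[d PQd].
  by rewrite -/(prokhorov P Q) subrKC => de; exists d.
by apply: le_lt_trans de; apply: ge_inf => //; exact: (prokhorov_has_inf P Q).2.
Qed.

Let pball P e : set (measures X) := [set Q | prokhorov P Q < e].

Let pball_center P e : 0 < e -> pball P e P.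
Proof.
move=> e0; apply/prokhorov_ltP; exists (e / 2).
  by apply: prokhorov_closexx; rewrite divr_gt0.
by rewrite ltr_pdivrMr// ltr_pMr// ltr1n.
Qed.

Let pball_sym P Q e : pball P e Q -> pball Q e P.
Proof.
by move=> /prokhorov_ltP[d /prokhorov_close_sym PQ de]; apply/prokhorov_ltP; exists d.
Qed.

Let pball_triangle P Q S e1 e2 :
  pball P e1 Q -> pball Q e2 S -> pball P (e1 + e2) S.
Proof.
move=> /prokhorov_ltP[d1 PQ d1e] /prokhorov_ltP[d2 QS d2e].
apply/prokhorov_ltP; exists (d1 + d2); last exact: ltrD.
exact: prokhorov_close_trans PQ QS.
Qed.

HB.instance Definition _ := Pointed.on (measures X).
HB.instance Definition _ := hasNbhs.Build (measures X)
  (nbhs_ (entourage_ pball)).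
HB.instance Definition _ := @Nbhs_isPseudoMetric.Build R (measures X)
  (entourage_ pball) erefl pball pball_center pball_sym pball_triangle erefl.

Lemma measures_ballE P e : ball P e = [set Q | prokhorov P Q < e].
Proof. by []. Qed.

End prokhorov_theory.

Section constructive_structure.
Variables (R : realType) (X : constructiveMetricType R).

(* A list of pairs (i, w) names the finitely supported measure giving
   ideal_point i weight proportional to w (weights for repeated i add up); if all
   weights are 0 the name stands for the point mass at ideal_point 0. *)
Definition ideal_measure_name := seq (nat * nat).
Definition ideal_measure (s : ideal_measure_name) : measures X :=
  mnormalize
    (msum (fun k => mscale ((nth (0%N, 0%N) s k).2%:R)%:nng
                      (dirac (ideal_point (nth (0%N, 0%N) s k).1 : borel X)))
          (size s))
    (dirac (ideal_point 0%N : borel X)).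

Definition ball_name := (nat * posrat_name)%type.
Definition basic_ball (i : ball_name) : set X :=
  ball (ideal_point i.1) (posrat_of R i.2).

Definition mball_name := (ideal_measure_name * posrat_name)%type.
Definition basic_mball (i : mball_name) : set (measures X) :=
  ball (ideal_measure i.1) (posrat_of R i.2).

Definition basic_prod (i : ball_name * mball_name) : set (X * measures X) :=
  basic_ball i.1 `*` basic_mball i.2.

End constructive_structure.

Section tests.
Variables (R : realType) (X : constructiveMetricType R).
Local Open Scope ereal_scope.

Definition effectively_compact (C : set (measures X)) : Prop :=
  compact C /\
  enumerable [set s : seq mball_name |
    C `<=` \bigcup_(i in [set j | j \in s]) basic_mball i].

(* [B] is a family of named basic balls; uniformity in the rational level q is the
   enumerability of a single set E of pairs (q, i). *)
Definition lower_semicomputable (T : Type) (I : countType) (B : I -> set T)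
    (f : T -> \bar R) : Prop :=
  (forall x, 0 <= f x) /\
  exists2 E : set (rat_name * I), enumerable E &
    forall q, [set x | (rat_of R q)%:E < f x] = \bigcup_(i in [set j | E (q, j)]) B i.

Definition lower_semicomputable1 (t : X -> \bar R) : Prop :=
  lower_semicomputable (@basic_ball R X) t.

Definition lower_semicomputable2 (t : X -> measures X -> \bar R) : Prop :=
  lower_semicomputable (@basic_prod R X) (fun xP => t xP.1 xP.2).

Definition class_test (C : set (measures X)) (t : X -> \bar R) : Prop :=
  lower_semicomputable1 t /\
  forall P, C P -> \int[P]_(x in [set: borel X]) t x <= 1.

Definition uniform_test (t : X -> measures X -> \bar R) : Prop :=
  lower_semicomputable2 t /\
  forall P : measures X, \int[P]_(x in [set: borel X]) t x P <= 1.

Definition universal_class_test (C : set (measures X)) (t : X -> \bar R) : Prop :=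
  class_test C t /\
  forall u, class_test C u ->
    exists2 c : R, (0 < c)%R & forall x, u x <= c%:E * t x.

Definition universal_uniform_test (t : X -> measures X -> \bar R) : Prop :=
  uniform_test t /\
  forall u, uniform_test u ->
    exists2 c : R, (0 < c)%R & forall x P, u x P <= c%:E * t x P.

Definition Randoms (t : X -> measures X -> \bar R) (P : measures X) : set X :=
  [set x | t x P < +oo].

(* Randoms is taken with respect to the universal uniform test t; universal tests
   differ by bounded factors, so the choice of t is immaterial. *)
Definition effectively_orthogonal (t : X -> measures X -> \bar R)
    (C : set (measures X)) : Prop :=
  forall P Q, C P -> C Q -> ~ same_measure P Q ->
    Randoms t P `&` Randoms t Q = set0.

Definition test_separator (C : set (measures X)) (s : X -> measures X -> \bar R) :
    Prop :=
  uniform_test s /\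
  forall P Q, C P -> C Q -> ~ same_measure P Q ->
    forall x, s x P = +oo \/ s x Q = +oo.

End tests.

(* Main.v *)
(* The function u(x) = inf over Q in C of max(t(x,Q), s(x,Q)) is lower semicomputable,
   since C is effectively compact, and has integral at most 2 under each P in C, so it is
   dominated by tC.  If s(x,P) is finite then s(x,Q) is infinite for every other Q in C, so
   the infimum is attained at P and t(x,P) <= u(x).

   Conversely s is itself a uniform test, and tC is trimmed to a uniform test: tC is
   approximated from below by an increasing sequence of step functions g_i, and g_i is only
   taken into account at the measures Q in an effectively open set U_i which contains C and
   on which the integral of g_i is at most 4.  The set U_i is a union of small balls around
   ideal measures, on which the condition on the integral is decidable. *)

Require Import Defs.
From mathcomp Require Import all_boot all_order all_algebra.
From mathcomp Require Import all_classical all_reals all_analysis.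
From mathcomp Require Import measurable_realfun.
From mathcomp Require Import zify ring lra.

Set Implicit Arguments.
Unset Strict Implicit.
Unset Printing Implicit Defensive.

(** * Recursive functions on codes *)

Definition recursive1 (g : nat -> nat) : Prop :=
  recursive (fun v : 1.-tuple nat => g (thead v)).

Definition recursive2 (g : nat -> nat -> nat) : Prop :=
  recursive (fun v : 2.-tuple nat => g (thead v) (thead (behead_tuple v))).

Lemma recursive_ext n (f g : n.-tuple nat -> nat) :
  f =1 g -> recursive f -> recursive g.
Proof. by move=> /funext ->. Qed.

Lemma recursive_comp1 n (g : nat -> nat) (f : n.-tuple nat -> nat) :
  recursive1 g -> recursive f -> recursive (fun v => g (f v)).
Proof.
move=> rg rf.
apply: recursive_ext (recursive_comp (m := 1) (g := fun=> f) rg (fun=> rf)) => v.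
by rewrite [thead _]tnth_mktuple.
Qed.

Lemma recursive_comp2 n (g : nat -> nat -> nat) (f1 f2 : n.-tuple nat -> nat) :
  recursive2 g -> recursive f1 -> recursive f2 ->
  recursive (fun v => g (f1 v) (f2 v)).
Proof.
move=> rg r1 r2.
have rf (i : 'I_2) : recursive (if i == ord0 then f1 else f2) by case: eqP.
apply: recursive_ext (recursive_comp (m := 2)
  (g := fun i => if i == ord0 then f1 else f2) rg rf) => v.
rewrite [thead _]tnth_mktuple /=; congr (g _ _).
by rewrite [thead _]tnth_behead tnth_mktuple -val_eqE /= inordK.
Qed.

Lemma recursive_comp3 n (g : 3.-tuple nat -> nat) (f1 f2 f3 : n.-tuple nat -> nat) :
  recursive g -> recursive f1 -> recursive f2 -> recursive f3 ->
  recursive (fun v => g [tuple f1 v; f2 v; f3 v]).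
Proof.
move=> rg r1 r2 r3.
pose h (i : 'I_3) := nth f1 [:: f1; f2; f3] i.
have rh i : recursive (h i) by rewrite /h; case: i => [[|[|[|//]]] /= _].
apply: recursive_ext (recursive_comp (m := 3) rg rh) => v.
congr g; apply: eq_from_tnth => i; rewrite tnth_mktuple.
by case: i => [[|[|[|//]]] ?]; rewrite (tnth_nth 0).
Qed.

Lemma recursive1_id : recursive1 id.
Proof. exact: (recursive_proj ord0). Qed.

Lemma recursive_thead n : recursive (fun v : n.+1.-tuple nat => thead v).
Proof. exact: (recursive_proj ord0). Qed.

Lemma recursive_thead2 n :
  recursive (fun v : n.+2.-tuple nat => thead (behead_tuple v)).
Proof.
apply: recursive_ext (recursive_proj (inord 1)) => v /=.
by rewrite [RHS]tnth_behead.
Qed.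

Lemma recursive_thead3 n :
  recursive (fun v : n.+3.-tuple nat => thead (behead_tuple (behead_tuple v))).
Proof.
apply: recursive_ext (recursive_proj (inord 2)) => v /=.
by rewrite [RHS]tnth_behead tnth_behead inordK.
Qed.

Lemma theadD n (v : n.+2.-tuple nat) : thead (behead_tuple v) = nth 0 v 1.
Proof. by rewrite [LHS](tnth_nth 0) nth_behead. Qed.

Lemma recursive1_comp (f g : nat -> nat) :
  recursive1 f -> recursive1 g -> recursive1 (fun x => f (g x)).
Proof. exact: recursive_comp1. Qed.

Lemma recursive1_comp2 (g : nat -> nat -> nat) (f1 f2 : nat -> nat) :
  recursive2 g -> recursive1 f1 -> recursive1 f2 ->
  recursive1 (fun x => g (f1 x) (f2 x)).
Proof. exact: recursive_comp2. Qed.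

Lemma recursive1_const c : recursive1 (fun=> c).
Proof.
elim: c => [|c IH]; first exact: recursive_zero.
exact: (recursive1_comp (f := succn) recursive_succ IH).
Qed.

Lemma recursive2_prec (f : nat -> nat) (g : nat -> nat -> nat -> nat) :
  recursive1 f ->
  recursive (fun v : 3.-tuple nat =>
    g (thead v) (thead (behead_tuple v)) (thead (behead_tuple (behead_tuple v)))) ->
  recursive2 (fun n x => nat_rect (fun=> nat) (f x) (fun k y => g k y x) n).
Proof.
move=> rf rg.
apply: recursive_ext (recursive_prec rf rg) => v.
elim: (thead v) => [//|k IH] /=; rewrite -IH.
set y := nat_rect _ _ _ _.
by congr g; rewrite !theadD /= nth_behead.
Qed.

Lemma recursive2_swap (g : nat -> nat -> nat) :
  recursive2 g -> recursive2 (fun x y => g y x).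
Proof.
by move=> rg; apply: recursive_comp2 rg (recursive_thead2 0) (recursive_thead 1).
Qed.

Lemma recursive2_add : recursive2 addn.
Proof.
have := recursive2_prec (g := fun _ y _ => y.+1) recursive1_id
  (recursive_comp1 (g := succn) recursive_succ (recursive_thead2 1)).
by apply: recursive_ext => v; elim: (thead v) => //= k ->; rewrite addSn.
Qed.

Lemma recursive2_mul : recursive2 muln.
Proof.
have := recursive2_prec (g := fun _ y x => x + y) (recursive1_const 0)
  (recursive_comp2 recursive2_add (recursive_thead3 0) (recursive_thead2 1)).
by apply: recursive_ext => v; elim: (thead v) => //= k ->; rewrite mulSn.
Qed.

Lemma recursive2_exp : recursive2 expn.
Proof.
apply: (@recursive2_swap (fun k x => x ^ k)).
have := recursive2_prec (g := fun _ y x => x * y) (recursive1_const 1)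
  (recursive_comp2 recursive2_mul (recursive_thead3 0) (recursive_thead2 1)).
by apply: recursive_ext => v; elim: (thead v) => //= k ->; rewrite expnS.
Qed.

Lemma recursive1_pred : recursive1 predn.
Proof.
have := recursive2_prec (g := fun k _ _ => k) (recursive1_const 0)
  (recursive_thead 2).
move=> /(recursive1_comp2 (f1 := id) (f2 := id)) /(_ recursive1_id recursive1_id).
by apply: recursive_ext => v; case: (thead v).
Qed.

Lemma recursive2_sub : recursive2 subn.
Proof.
apply: (@recursive2_swap (fun k x => x - k)).
have := recursive2_prec (g := fun _ y _ => y.-1) recursive1_id
  (recursive_comp1 recursive1_pred (recursive_thead2 1)).
by apply: recursive_ext => v; elim: (thead v) => [|k /= ->]; rewrite ?subn0 ?subnS.
Qed.

Lemma recursive1_half : recursive1 half.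
Proof.
have := recursive2_prec (g := fun k y _ => k - y) (recursive1_const 0)
  (recursive_comp2 recursive2_sub (recursive_thead 2) (recursive_thead2 1)).
move=> /(recursive1_comp2 (f1 := id) (f2 := id)) /(_ recursive1_id recursive1_id).
apply: recursive_ext => v; elim: (thead v) => [//|k /= ->] /=.
by rewrite uphalf_half -{1}(odd_double_half k) -addnn; lia.
Qed.

Definition cons_code n m := 2 ^ n * m.*2.+1.

Lemma recursive2_cons_code : recursive2 cons_code.
Proof.
rewrite (_ : cons_code = fun n m => 2 ^ n * (m + m).+1); last first.
  by apply/funext => n; apply/funext => m; rewrite /cons_code addnn.
apply: (recursive_comp2 recursive2_mul).
  exact: recursive_comp2 recursive2_exp (recursive_comp1 (recursive1_const 2)
    (recursive_thead 1)) (recursive_thead 1).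
apply: (recursive_comp1 (g := succn)); first exact: recursive_succ.
exact: recursive_comp2 recursive2_add (recursive_thead2 0) (recursive_thead2 0).
Qed.

Definition head_code (m : nat) : nat := logn 2 m.

Definition tail_code (m : nat) : nat := (iter (head_code m) half m)./2.

Lemma iter_half_mul n k : iter n half (2 ^ n * k) = k.
Proof.
by elim: n k => [|n IH] k; rewrite ?mul1n// expnS -mulnA mul2n iterSr doubleK.
Qed.

Lemma head_codeK n m : head_code (cons_code n m) = n.
Proof.
rewrite /head_code /cons_code lognM ?expn_gt0// lognX logn_prime// eqxx muln1.
by rewrite lognE /= dvdn2 /= odd_double addn0.
Qed.

Lemma tail_codeK n m : tail_code (cons_code n m) = m.
Proof. by rewrite /tail_code head_codeK iter_half_mul /= uphalf_double. Qed.

Lemma recursive2_iter (f : nat -> nat) :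
  recursive1 f -> recursive2 (fun n => iter n f).
Proof.
move=> rf; have := recursive2_prec (g := fun _ y _ => f y) recursive1_id
  (recursive_comp1 rf (recursive_thead2 1)).
by apply: recursive_ext => v; elim: (thead v) => //= k ->.
Qed.

Lemma recursive1_odd : recursive1 (fun n => odd n).
Proof.
have := recursive_comp2 recursive2_add recursive1_half recursive1_half.
move=> /(recursive_comp2 recursive2_sub recursive1_id).
apply: recursive_ext => v; rewrite addnn.
by rewrite -{1}(odd_double_half (thead v)) addnK.
Qed.

Lemma recursive1_head_code : recursive1 head_code.
Proof.
have rt : recursive2 (fun k m => 1 - ((1 - m) + odd (iter k half m))).
  apply: recursive_comp2 recursive2_sub
    (recursive_comp1 (recursive1_const 1) (recursive_thead 1)) _.
  apply: (recursive_comp2 recursive2_add).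
    exact: recursive_comp2 recursive2_sub
      (recursive_comp1 (recursive1_const 1) (recursive_thead 1)) (recursive_thead2 0).
  exact: recursive_comp1 recursive1_odd (recursive2_iter recursive1_half).
have consE n k m : (0 < m) -> m = cons_code n k -> head_code m = n /\
    odd (iter n half m) /\ forall j, j < n -> ~~ odd (iter j half m).
  move=> m0 ->; rewrite head_codeK /cons_code iter_half_mul /= odd_double.
  split=> //; split=> // j jn.
  by rewrite -(subnK jn) addnS -addSn addnC expnD -mulnA iter_half_mul expnS -mulnA
    mul2n odd_double.
have codeP m : 0 < m -> exists k, m = cons_code (head_code m) k.
  move=> m0; have [q q0 mE] := pfactor_coprime (isT : prime 2) m0.
  exists q./2; rewrite {1}mE /cons_code mulnC; congr (_ * _).
  by rewrite coprime2n in q0; rewrite -[LHS]odd_double_half q0.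
rewrite /recursive1; apply: (recursive_mu rt) => [v|v k].
  rewrite /= theadD /= -(tnth_nth 0 v ord0) -/(thead v) theadE.
  case: (posnP (thead v)) => [->//|m0].
  by have [k /(consE _ _ _ m0)[_ [-> _]]] := codeP _ m0; rewrite addnC.
rewrite /= theadD /= -(tnth_nth 0 v ord0) -/(thead v) theadE.
case: (posnP (thead v)) => [->//|m0].
have [j /(consE _ _ _ m0)[_ [_ h]]] := codeP _ m0.
by move=> /h /negbTE ->; rewrite addn0; case: (thead v) m0.
Qed.

Lemma recursive1_tail_code : recursive1 tail_code.
Proof.
apply: (recursive_comp1 recursive1_half).
exact: recursive_comp2 (recursive2_iter recursive1_half) recursive1_head_code
  recursive1_id.
Qed.

Definition pair_code x y := cons_code x (cons_code y 0).
Definition fst_code := head_code.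
Definition snd_code m := head_code (tail_code m).

Lemma fst_codeK x y : fst_code (pair_code x y) = x.
Proof. exact: head_codeK. Qed.

Lemma snd_codeK x y : snd_code (pair_code x y) = y.
Proof. by rewrite /snd_code tail_codeK head_codeK. Qed.

Lemma recursive2_pair_code : recursive2 pair_code.
Proof.
apply: (recursive_comp2 recursive2_cons_code); first exact: recursive_thead.
apply: (recursive_comp2 recursive2_cons_code); first exact: recursive_thead2.
exact: recursive_comp1 (recursive1_const 0) (recursive_thead 1).
Qed.

Lemma recursive1_fst_code : recursive1 fst_code.
Proof. exact: recursive1_head_code. Qed.

Lemma recursive1_snd_code : recursive1 snd_code.
Proof. exact: recursive1_comp recursive1_head_code recursive1_tail_code. Qed.

Lemma pickle_pairE (A B : countType) (a : A) (b : B) :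
  pickle (a, b) = pair_code (pickle a) (pickle b).
Proof. by []. Qed.

Lemma pickle_nil (A : countType) : pickle ([::] : seq A) = 0.
Proof. by []. Qed.

Lemma pickle_cons (A : countType) (a : A) l :
  pickle (a :: l) = cons_code (pickle a) (pickle l).
Proof. by []. Qed.

Lemma recursive1_prec (f g h : nat -> nat) :
  recursive1 f -> recursive1 g -> recursive1 h ->
  recursive1 (fun x => nat_rect (fun=> nat) (f x)
    (fun k y => g (pair_code (pair_code x k) y)) (h x)).
Proof.
move=> rf rg rh.
have := recursive2_prec (g := fun k y x => g (pair_code (pair_code x k) y)) rf
  (recursive_comp1 rg (recursive_comp2 recursive2_pair_code
    (recursive_comp2 recursive2_pair_code (recursive_thead3 0) (recursive_thead 2))
    (recursive_thead2 1))).
by move=> /recursive1_comp2 /(_ rh recursive1_id).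
Qed.

(** * Computable functions and semidecidable predicates *)

Definition computable (A B : countType) (f : A -> B) : Prop :=
  exists2 g : nat -> nat, recursive1 g & forall a, g (pickle a) = pickle (f a).

Definition decidable_pred (A : countType) (p : A -> bool) : Prop :=
  computable (fun a => nat_of_bool (p a)).

Section computable.
Implicit Types A B D : countType.

Lemma computable_id A : computable (@id A).
Proof. by exists id => //; exact: recursive1_id. Qed.

Lemma computable_const A B (b : B) : computable (fun _ : A => b).
Proof. by exists (fun=> pickle b) => //; exact: recursive1_const. Qed.

Lemma computable_comp A B D (f : B -> D) (g : A -> B) :
  computable f -> computable g -> computable (fun a => f (g a)).
Proof.
move=> [f' rf fE] [g' rg gE]; exists (fun x => f' (g' x)).
  exact: recursive1_comp.
by move=> a; rewrite gE fE.
Qed.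

Lemma computable_pair A B D (f : A -> B) (g : A -> D) :
  computable f -> computable g -> computable (fun a => (f a, g a)).
Proof.
move=> [f' rf fE] [g' rg gE]; exists (fun x => pair_code (f' x) (g' x)).
  exact: recursive1_comp2 recursive2_pair_code rf rg.
by move=> a; rewrite gE fE.
Qed.

Lemma computable_fst A B D (f : A -> B * D) :
  computable f -> computable (fun a => (f a).1).
Proof.
apply: (@computable_comp _ _ _ fst).
exists fst_code; first exact: recursive1_fst_code.
by move=> [a b]; rewrite pickle_pairE fst_codeK.
Qed.

Lemma computable_snd A B D (f : A -> B * D) :
  computable f -> computable (fun a => (f a).2).
Proof.
apply: (@computable_comp _ _ _ snd).
exists snd_code; first exact: recursive1_snd_code.
by move=> [a b]; rewrite pickle_pairE snd_codeK.
Qed.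

Lemma computable_pickle A B (f : A -> B) :
  computable f -> computable (fun a => pickle (f a)).
Proof. by move=> [f' rf fE]; exists f'. Qed.

Lemma computable_nat1 A (g : nat -> nat) (f : A -> nat) :
  recursive1 g -> computable f -> computable (fun a => g (f a)).
Proof.
by move=> rg; apply: (@computable_comp _ _ _ g); exists g.
Qed.

Lemma computable_nat2 A (g : nat -> nat -> nat) (f1 f2 : A -> nat) :
  recursive2 g -> computable f1 -> computable f2 ->
  computable (fun a => g (f1 a) (f2 a)).
Proof.
move=> rg [f1' rf1 f1E] [f2' rf2 f2E]; exists (fun x => g (f1' x) (f2' x)).
  exact: recursive1_comp2.
by move=> a; rewrite f1E f2E.
Qed.

Lemma computable_nat3 A (g : 3.-tuple nat -> nat) (f1 f2 f3 : A -> nat) :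
  recursive g -> computable f1 -> computable f2 -> computable f3 ->
  computable (fun a => g [tuple f1 a; f2 a; f3 a]).
Proof.
move=> rg [f1' rf1 f1E] [f2' rf2 f2E] [f3' rf3 f3E].
exists (fun x => g [tuple f1' x; f2' x; f3' x]).
  exact: recursive_comp3.
by move=> a; rewrite f1E f2E f3E.
Qed.

Lemma computable_prec A B (f : A -> B) (g : A * nat * B -> B) (n : A -> nat) :
  computable f -> computable g -> computable n ->
  computable (fun a => nat_rect (fun=> B) (f a) (fun k y => g (a, k, y)) (n a)).
Proof.
move=> [f' rf fE] [g' rg gE] [n' rn nE].
eexists; first exact: recursive1_prec rf rg rn.
move=> a; rewrite /= nE -[pickle (n a)]/(n a).
by elim: (n a) => [|k /= ->]; [exact: fE|rewrite -gE].
Qed.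

Lemma computable_if A B (p : A -> bool) (f g : A -> B) :
  decidable_pred p -> computable f -> computable g ->
  computable (fun a => if p a then f a else g a).
Proof.
move=> cp cf cg.
have := computable_prec (g := fun x => f x.1.1) cg
  (computable_comp cf (computable_fst (computable_fst (computable_id _)))) cp.
congr computable; apply/funext => a; by case: (p a).
Qed.

Lemma computable_sum A (F : A * nat -> nat) (n : A -> nat) :
  computable F -> computable n -> computable (fun a => \sum_(k < n a) F (a, k : nat)).
Proof.
move=> cF cn.
have := computable_prec (g := fun x => x.2 + F x.1) (computable_const _ 0)
  (computable_nat2 recursive2_add (computable_snd (computable_id _))
  (computable_comp cF (computable_fst (computable_id _)))) cn.
congr computable; apply/funext => a.
by elim: (n a) => [|k /= ->]; rewrite ?big_ord0 ?big_ord_recr.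
Qed.

Lemma decidable_leq A (f g : A -> nat) :
  computable f -> computable g -> decidable_pred (fun a => f a <= g a).
Proof.
move=> cf cg; have := computable_nat2 recursive2_sub (computable_const _ 1)
  (computable_nat2 recursive2_sub cf cg).
by congr computable; apply/funext => a; rewrite /leq; case: (f a - g a).
Qed.

Lemma decidable_ltn A (f g : A -> nat) :
  computable f -> computable g -> decidable_pred (fun a => f a < g a).
Proof.
by move=> cf; apply: decidable_leq; apply: (computable_nat1 (g := succn)) cf;
  exact: recursive_succ.
Qed.

Lemma decidable_and A (p q : A -> bool) :
  decidable_pred p -> decidable_pred q -> decidable_pred (fun a => p a && q a).
Proof.
move=> cp cq; have := computable_nat2 recursive2_mul cp cq.
by congr computable; apply/funext => a; rewrite mulnb.
Qed.

Lemma decidable_not A (p : A -> bool) :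
  decidable_pred p -> decidable_pred (fun a => ~~ p a).
Proof.
move=> cp; have := computable_nat2 recursive2_sub (computable_const _ 1) cp.
by congr computable; apply/funext => a; case: (p a).
Qed.

Lemma decidable_or A (p q : A -> bool) :
  decidable_pred p -> decidable_pred q -> decidable_pred (fun a => p a || q a).
Proof.
move=> cp cq.
have := decidable_not (decidable_and (decidable_not cp) (decidable_not cq)).
by congr computable; apply/funext => a; rewrite negb_and !negbK.
Qed.

Lemma decidable_eq A B (f g : A -> B) :
  computable f -> computable g -> decidable_pred (fun a => f a == g a).
Proof.
move=> /computable_pickle cf /computable_pickle cg.
have := decidable_and (decidable_leq cf cg) (decidable_leq cg cf).
congr computable; apply/funext => a; rewrite -eqn_leq.
by rewrite (inj_eq (pcan_inj pickleK)).
Qed.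

Lemma decidable_comp A B (p : B -> bool) (f : A -> B) :
  decidable_pred p -> computable f -> decidable_pred (fun a => p (f a)).
Proof. exact: computable_comp. Qed.

Lemma decidable_exists A (p : A * nat -> bool) (n : A -> nat) :
  decidable_pred p -> computable n ->
  decidable_pred (fun a => [exists k : 'I_(n a), p (a, k : nat)]).
Proof.
move=> cp cn.
have := decidable_ltn (computable_const _ 0) (computable_sum cp cn).
congr computable; apply/funext => a; congr nat_of_bool.
rewrite lt0n sum_nat_eq0 negb_forall; apply: eq_existsb => k /=.
by rewrite eqb0 negbK.
Qed.

Lemma computable_cons A B (f : A -> B) (l : A -> seq B) :
  computable f -> computable l -> computable (fun a => f a :: l a).
Proof.
move=> [f' rf fE] [l' rl lE]; exists (fun x => cons_code (f' x) (l' x)).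
  exact: recursive1_comp2 recursive2_cons_code rf rl.
by move=> a; rewrite lE fE.
Qed.

Lemma size_leq_pickle A (l : seq A) : size l <= pickle l.
Proof.
elim: l => //= a l IH; rewrite pickle_cons /cons_code.
apply: (@leq_trans (1 * (pickle l).*2.+1)); last by rewrite leq_mul2r expn_gt0 orbT.
by rewrite mul1n ltnS -addnn (leq_trans IH) ?leq_addl.
Qed.

Lemma computable_drop A B (l : A -> seq B) (n : A -> nat) :
  computable l -> computable n -> computable (fun a => drop (n a) (l a)).
Proof.
move=> cl cn.
apply: (@computable_comp _ _ _ (fun x : seq B * nat => drop x.2 x.1)
  (fun a => (l a, n a))); last exact: computable_pair.
exists (fun x => iter (snd_code x) tail_code (fst_code x)).
  exact: recursive1_comp2 (recursive2_iter recursive1_tail_code)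
    recursive1_snd_code recursive1_fst_code.
move=> [s k]; rewrite pickle_pairE snd_codeK fst_codeK /= -[pickle k]/k.
elim: k s => [|k IH] s; rewrite ?drop0// iterSr.
case: s => [|b s]; last by rewrite pickle_cons tail_codeK IH.
by rewrite /= -(IH [::]) pickle_nil.
Qed.

Lemma computable_head A B (b0 : B) (l : A -> seq B) :
  computable l -> computable (fun a => head b0 (l a)).
Proof.
move=> cl; apply: (@computable_comp _ _ _ (head b0)) cl.
suff : computable (fun s : seq B =>
    if pickle s == 0 then pickle b0 else head_code (pickle s)).
  move=> [g rg gE]; exists g => // -[|b s]; rewrite gE //.
  by rewrite pickle_cons head_codeK /cons_code muln_eq0 expn_eq0.
apply: computable_if.
- apply: (decidable_eq (B := nat)); last exact: computable_const.
  exact: computable_pickle (computable_id _).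
- exact: computable_const.
- exact: computable_nat1 recursive1_head_code (computable_pickle (computable_id _)).
Qed.

(* The fold is computed by recursion on suffixes of the list; its code bounds the
   number of suffixes. *)
Lemma computable_foldr A B D (b0 : B) (G : A * B * D -> D) (z : A -> D)
    (l : A -> seq B) :
  computable G -> computable z -> computable l ->
  computable (fun a => foldr (fun b y => G (a, b, y)) (z a) (l a)).
Proof.
move=> cG cz cl; pose N a := pickle (l a).
have cN : computable N := computable_pickle cl.
pose s (x : A * nat * D) := drop (N x.1.1 - x.1.2.+1) (l x.1.1).
have c1 : computable (fun x : A * nat * D => x.1.1).
  exact: computable_fst (computable_fst (computable_id _)).
have cs : computable s.
  apply: computable_drop; first exact: computable_comp cl c1.
  apply: (computable_nat2 recursive2_sub); first exact: computable_comp cN c1.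
  apply: (computable_nat1 (g := succn)); first exact: recursive_succ.
  exact: computable_snd (computable_fst (computable_id _)).
have c2 : computable (fun x : A * nat * D => x.2).
  exact: computable_snd (computable_id _).
have cstep : computable (fun x : A * nat * D =>
    if s x == [::] then x.2 else G (x.1.1, head b0 (s x), x.2)).
  apply: computable_if => //.
    by apply: decidable_eq => //; exact: computable_const.
  apply: (computable_comp cG); apply: computable_pair => //.
  by apply: computable_pair => //; exact: computable_head.
have := computable_prec cz cstep cN.
congr computable; apply/funext => a.
set h := foldr _ _.
suff H k : k <= N a -> nat_rect (fun=> D) (z a) (fun k y => if s (a, k, y) == [::]
    then y else G (a, head b0 (s (a, k, y)), y)) k = h (drop (N a - k) (l a)).
  by rewrite H// subnn drop0.
elim: k => [|k IH] kN.
  by rewrite subn0 drop_oversize// size_leq_pickle.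
rewrite /= (IH (ltnW kN)) /s /=; rewrite -(subnSK kN).
case: (ltnP (N a - k.+1) (size (l a))) => lt; last first.
  by rewrite !drop_oversize// (leq_trans lt)// leqnSn.
by rewrite (drop_nth b0 lt).
Qed.

Lemma computable_map A B D (b0 : B) (f : A * B -> D) (l : A -> seq B) :
  computable f -> computable l ->
  computable (fun a => [seq f (a, b) | b <- l a]).
Proof.
move=> cf cl; apply: (computable_foldr b0 (G := fun x => f x.1 :: x.2)) => //.
  apply: computable_cons; last exact: computable_snd (computable_id _).
  exact: computable_comp cf (computable_fst (computable_id _)).
exact: computable_const.
Qed.

Lemma computable_sumseq A B (b0 : B) (F : A * B -> nat) (l : A -> seq B) :
  computable F -> computable l ->
  computable (fun a => \sum_(b <- l a) F (a, b)).
Proof.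
move=> cF cl.
have := computable_foldr b0 (G := fun x => F x.1 + x.2)
  (computable_nat2 recursive2_add
    (computable_comp cF (computable_fst (computable_id _)))
    (computable_snd (computable_id _))) (computable_const _ 0) cl.
congr computable; apply/funext => a; by rewrite unlock.
Qed.

Lemma decidable_all A B (b0 : B) (p : A * B -> bool) (l : A -> seq B) :
  decidable_pred p -> computable l ->
  decidable_pred (fun a => all (fun b => p (a, b)) (l a)).
Proof.
move=> cp cl.
have := computable_foldr b0 (G := fun x => p x.1 * x.2)
  (computable_nat2 recursive2_mul
    (computable_comp cp (computable_fst (computable_id _)))
    (computable_snd (computable_id _))) (computable_const _ 1) cl.
congr computable; apply/funext => a.
by elim: (l a) => //= b s ->; rewrite mulnb.
Qed.

End computable.

Lemma computable_succ (A : countType) (f : A -> nat) :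
  computable f -> computable (fun a => (f a).+1).
Proof. by apply: (computable_nat1 (g := succn)); exact: recursive_succ. Qed.

Lemma computable_add (A : countType) (f g : A -> nat) :
  computable f -> computable g -> computable (fun a => f a + g a).
Proof. exact: computable_nat2 recursive2_add. Qed.

Lemma computable_mul (A : countType) (f g : A -> nat) :
  computable f -> computable g -> computable (fun a => f a * g a).
Proof. exact: computable_nat2 recursive2_mul. Qed.

Lemma computable_exp (A : countType) (f g : A -> nat) :
  computable f -> computable g -> computable (fun a => f a ^ g a).
Proof. exact: computable_nat2 recursive2_exp. Qed.

Ltac computability := repeat (simpl; first [ assumption |
  lazymatch goal with
  | |- computable (fun a => a) => exact: computable_id
  | |- computable fst => exact: computable_fst (computable_id _)
  | |- computable snd => exact: computable_snd (computable_id _)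
  | |- computable (fun _ => (_, _)) => apply: computable_pair
  | |- computable (fun _ => fst _) => apply: computable_fst
  | |- computable (fun _ => snd _) => apply: computable_snd
  | |- computable (fun _ => pickle _) => apply: computable_pickle
  | |- computable (fun _ => addn _ _) => apply: computable_add
  | |- computable (fun _ => muln _ _) => apply: computable_mul
  | |- computable (fun _ => expn _ _) => apply: computable_exp
  | |- decidable_pred (fun _ => ~~ _) => apply: decidable_not
  | |- decidable_pred (fun _ => _ && _) => apply: decidable_and
  | |- decidable_pred (fun _ => _ || _) => apply: decidable_or
  | |- decidable_pred (fun _ => _ < _) => apply: decidable_ltn
  | |- decidable_pred (fun _ => _ <= _) => apply: decidable_leq
  | |- decidable_pred (fun _ => _ == _) => apply: decidable_eq
  | |- computable (fun _ => _.+1) => apply: computable_succ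
  | |- computable (fun _ => if _ then _ else _) => apply: computable_if
  | |- computable (fun _ => _) => apply: computable_const
  end ]).

Definition effective (A : countType) : Prop :=
  exists2 e : nat -> A, computable e & forall a, exists n, e n = a.

Definition semidecidable (A : countType) (E : A -> Prop) : Prop :=
  exists2 p : A * nat -> bool, decidable_pred p & forall a, E a <-> exists w, p (a, w).

Lemma computable_fst_code (A : countType) (f : A -> nat) :
  computable f -> computable (fun a => fst_code (f a)).
Proof. exact: computable_nat1 recursive1_fst_code. Qed.

Lemma computable_snd_code (A : countType) (f : A -> nat) :
  computable f -> computable (fun a => snd_code (f a)).
Proof. exact: computable_nat1 recursive1_snd_code. Qed.

Section semidecidable.
Implicit Types A B D : countType.

Lemma effective_nat : effective nat.
Proof. by exists id; [exact: computable_id|move=> n; exists n]. Qed.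

Lemma effective_pair A B : effective A -> effective B -> effective (A * B)%type.
Proof.
move=> [e ce eP] [f cf fP]; exists (fun n => (e (fst_code n), f (snd_code n))).
  apply: computable_pair; apply: computable_comp => //.
  - exact: computable_fst_code (computable_id _).
  - exact: computable_snd_code (computable_id _).
move=> [a b]; have [n <-] := eP a; have [m <-] := fP b.
by exists (pair_code n m); rewrite fst_codeK snd_codeK.
Qed.

Lemma effective_seq A : effective A -> effective (seq A).
Proof.
move=> [e ce eP]; exists (fun n => [seq e k | k <- CodeSeq.decode n]).
  apply: (@computable_map _ _ _ 0 (fun x => e x.2)).
    exact: computable_comp ce (computable_snd (computable_id _)).
  exists id; first exact: recursive1_id.
  move=> n; rewrite -[LHS]/n -[LHS]CodeSeq.decodeK.
  by rewrite -[RHS]/(CodeSeq.code (map id _)) map_id.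
move=> l; have [s <-] : exists s, map e s = l.
  elim: l => [|a l [s <-]]; first by exists [::].
  by have [n <-] := eP a; exists (n :: s).
by exists (CodeSeq.code s); rewrite CodeSeq.codeK.
Qed.

Lemma semidecidable_ext A (E F : A -> Prop) :
  (forall a, E a <-> F a) -> semidecidable E -> semidecidable F.
Proof. by move=> EF [p cp pE]; exists p => // a; rewrite -EF. Qed.

Lemma decidable_semidecidable A (p : A -> bool) :
  decidable_pred p -> semidecidable p.
Proof.
move=> cp; exists (fun x => p x.1); last by move=> a; split=> [|[]//]; exists 0.
exact: decidable_comp cp (computable_fst (computable_id _)).
Qed.

Lemma semidecidable_comp A B (E : B -> Prop) (f : A -> B) :
  semidecidable E -> computable f -> semidecidable (fun a => E (f a)).
Proof.
move=> [p cp pE] cf; exists (fun x => p (f x.1, x.2)); last by move=> a; exact: pE.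
apply: (decidable_comp cp); apply: computable_pair; last by computability.
by apply: (computable_comp cf); computability.
Qed.

Lemma semidecidable_and A (E F : A -> Prop) :
  semidecidable E -> semidecidable F -> semidecidable (fun a => E a /\ F a).
Proof.
move=> [p cp pE] [q cq qF].
exists (fun x => p (x.1, fst_code x.2) && q (x.1, snd_code x.2)).
  apply: decidable_and; [apply: (decidable_comp cp)|apply: (decidable_comp cq)];
    apply: computable_pair.
  - by computability.
  - by apply: computable_fst_code; computability.
  - by computability.
  - by apply: computable_snd_code; computability.
move=> a; split=> [[/pE[v pv] /qF[w qw]]|[w /andP[pw qw]]].
  by exists (pair_code v w); rewrite /= fst_codeK snd_codeK pv.
by split; [apply/pE|apply/qF]; [exists (fst_code w)|exists (snd_code w)].
Qed.

Lemma semidecidable_or A (E F : A -> Prop) :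
  semidecidable E -> semidecidable F -> semidecidable (fun a => E a \/ F a).
Proof.
move=> [p cp pE] [q cq qF]; exists (fun x => p x || q x); first exact: decidable_or.
move=> a; split=> [[/pE[v pv]|/qF[w qw]]|[w /orP[pw|qw]]].
- by exists v; rewrite pv.
- by exists w; rewrite qw orbT.
- by left; apply/pE; exists w.
- by right; apply/qF; exists w.
Qed.

Lemma semidecidable_ex A B (E : A * B -> Prop) : effective B ->
  semidecidable E -> semidecidable (fun a => exists b, E (a, b)).
Proof.
move=> [e ce eP] [p cp pE].
exists (fun x => p (x.1, e (fst_code x.2), snd_code x.2)).
  apply: (decidable_comp cp); apply: computable_pair.
    apply: computable_pair; first by computability.
    by apply: (computable_comp ce); apply: computable_fst_code; computability.
  by apply: computable_snd_code; computability.
move=> a; split=> [[b /pE[w pw]]|[w pw]].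
  have [n nb] := eP b; exists (pair_code n w).
  by rewrite /= fst_codeK snd_codeK nb.
by exists (e (fst_code w)); apply/pE; exists (snd_code w).
Qed.

Lemma semidecidable_all A B (b0 : B) (E : A * B -> Prop) (l : A -> seq B) :
  computable l -> semidecidable E ->
  semidecidable (fun a => forall b, b \in l a -> E (a, b)).
Proof.
move=> cl [p cp pE].
(* A common bound for the witnesses of all members of the list. *)
pose q (x : A * nat * B) := [exists k : 'I_x.1.2, p (x.1.1, x.2, k : nat)].
exists (fun x : A * nat => all (fun b => q (x, b)) (l x.1)).
  apply: decidable_all => //; last exact: computable_comp cl (computable_fst (computable_id _)).
  apply: (decidable_exists (p := fun y => p (y.1.1.1, y.1.2, y.2))).
    by apply: (decidable_comp cp); computability.
  by computability.
move=> a; split=> [H|[w /allP H] b bl]; last first.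
  by have /existsP[k pk] := H _ bl; apply/pE; exists k.
elim: (l a) H => [|b s IH] H; first by exists 0.
have [|w Hw] := IH; first by move=> c cs; apply: H; rewrite inE cs orbT.
have [v pv] : exists v, p (a, b, v) by apply/pE/H; rewrite mem_head.
exists (maxn v.+1 w); apply/andP; split.
  by apply/existsP; exists (Ordinal (leq_maxl v.+1 w)).
apply/allP => c cs; have /existsP[k pk] := allP Hw _ cs.
by apply/existsP; exists (widen_ord (leq_maxr v.+1 w) k).
Qed.

Lemma enumerable_semidecidable A (E : set A) : enumerable E -> semidecidable E.
Proof.
move=> [f rf fE]; exists (fun x => f x.2 == (pickle x.1).+1).
  have cf : computable f by exists f.
  apply: decidable_eq; last by computability.
  by apply: (computable_comp cf); computability.
by move=> a; rewrite fE; split=> -[k /eqP ?]; exists k => //; apply/eqP.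
Qed.

Lemma semidecidable_enumerable A (E : set A) : semidecidable E -> enumerable E.
Proof.
move=> [p [g rg gp] pE].
pose f k := (fst_code k).+1 * (1 - (1 - g (pair_code (fst_code k) (snd_code k)))).
exists f; rewrite /f.
  rewrite -/(recursive1 f); apply: (recursive1_comp2 recursive2_mul).
    apply: (recursive1_comp (f := succn)) recursive1_fst_code.
    exact: recursive_succ.
  apply: (recursive1_comp2 recursive2_sub (recursive1_const 1)).
  apply: (recursive1_comp2 recursive2_sub (recursive1_const 1)).
  apply: (recursive1_comp rg).
  exact: recursive1_comp2 recursive2_pair_code recursive1_fst_code recursive1_snd_code.
move=> a; rewrite pE; split=> [[w pw]|[k]].
  exists (pair_code (pickle a) w); rewrite fst_codeK snd_codeK.
  by rewrite -[w in pair_code _ w]/(pickle w) -pickle_pairE gp pw muln1.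
case gk : (g _) => [|n]; first by rewrite muln0.
rewrite -[1 - (1 - n.+1)]/1 muln1 => -[ka]; exists (snd_code k); move: gk.
have := gp (a, snd_code k); rewrite pickle_pairE ka /= => ->.
by case: (p _).
Qed.

End semidecidable.

Import Order.TTheory GRing.Theory Num.Theory.
Import numFieldNormedType.Exports.

Local Open Scope classical_set_scope.
Local Open Scope ring_scope.

(** * Lower semicomputable functions *)

Section rational_codes.
Variable R : realType.

Definition rat_lt (q q' : rat_name) : bool :=
  (q.1.1 * q'.2.+1 + q'.1.2 * q.2.+1 < q'.1.1 * q.2.+1 + q.1.2 * q'.2.+1)%N.

Lemma rat_ltE q q' : rat_lt q q' = (rat_of R q < rat_of R q').
Proof.
rewrite /rat_of ltr_pdivrMr ?ltr0n// mulrAC ltr_pdivlMr ?ltr0n//.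
rewrite !mulrBl ltrBlDr addrAC ltrBrDr -!natrM -!natrD ltr_nat /rat_lt.
by congr (_ < _)%N; lia.
Qed.

Lemma decidable_rat_lt (A : countType) (f g : A -> rat_name) :
  computable f -> computable g -> decidable_pred (fun a => rat_lt (f a) (g a)).
Proof. by move=> cf cg; rewrite /rat_lt; computability. Qed.

Lemma effective_rat_name : effective (nat * nat * nat)%type.
Proof.
by apply: effective_pair effective_nat; apply: effective_pair; exact: effective_nat.
Qed.

Lemma rat_of_ratr (q : rat) : exists n : rat_name, rat_of R n = ratr q.
Proof.
have [d dq] : exists d : nat, denq q = d.+1%:Z.
  by exists `|denq q|.-1%N; have := denq_gt0 q; lia.
have [a [b ab]] : exists a b : nat, numq q = a%:Z - b%:Z.
  case: (numq q) => n; first by exists n, 0%N; rewrite subr0.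
  by exists 0%N, n.+1; rewrite sub0r NegzE.
exists (a, b, d); rewrite /rat_of /= /ratr dq ab.
by rewrite intrB -!pmulrn.
Qed.

Lemma rat_of_dense (x y : R) : x < y -> exists q, x < rat_of R q < y.
Proof.
move=> xy; have [q] := rat_in_itvoo xy; rewrite in_itv /= => qxy.
by have [n nq] := rat_of_ratr q; exists n; rewrite nq.
Qed.

Lemma rat_of_dense_ereal (x : R) (y : \bar R) :
  (x%:E < y)%E -> exists q, x < rat_of R q /\ ((rat_of R q)%:E < y)%E.
Proof.
case: y => [y| |//]; first by rewrite lte_fin => /rat_of_dense[q /andP[]]; exists q.
move=> _; have [|q /andP[xq _]] := @rat_of_dense x (x + 1); first by rewrite ltrDl.
by exists q; rewrite ltry.
Qed.

Lemma posrat_of_dense (x y : R) : 0 <= x -> x < y -> exists q, x < posrat_of R q < y.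
Proof.
move=> x0 xy; have [[[a b] d]] := rat_of_dense xy.
rewrite /rat_of /= => /andP[xq qy].
have ba : (b < a)%N.
  have := le_lt_trans x0 xq.
  by rewrite pmulr_lgt0 ?invr_gt0 ?ltr0n// subr_gt0 ltr_nat.
exists ((a - b).-1, d)%N; rewrite /posrat_of /= prednK ?subn_gt0// natrB ?(ltnW ba)//.
by rewrite xq.
Qed.

End rational_codes.

Section lower_semicomputable.
Variables (R : realType) (T : Type) (I : countType) (B : I -> set T).
Local Open Scope ereal_scope.

Definition sup_of_family (E : set (rat_name * I)) (x : T) : \bar R :=
  ereal_sup [set y | y = 0 \/ exists q i, [/\ E (q, i), B i x & y = (rat_of R q)%:E]].

Lemma sup_of_family_ge0 E x : 0 <= sup_of_family E x.
Proof. by apply: ereal_sup_ubound; left. Qed.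

Lemma sup_of_family_ub E q i x : E (q, i) -> B i x ->
  (rat_of R q)%:E <= sup_of_family E x.
Proof. by move=> Eqi Bx; apply: ereal_sup_ubound; right; exists q, i. Qed.

Lemma lower_semicomputable_sup_of_family (E : set (rat_name * I)) :
  (forall x, exists i, B i x) -> semidecidable E ->
  lower_semicomputable B (sup_of_family E).
Proof.
move=> cov sE; split; first exact: sup_of_family_ge0.
pose F (qi : rat_name * I) := rat_lt qi.1 (0, 0, 0)%N \/
  exists q', E (q', qi.2) /\ rat_lt qi.1 q'.
exists F.
  apply: semidecidable_enumerable; apply: semidecidable_or.
    by apply: decidable_semidecidable; apply: decidable_rat_lt; computability.
  apply: (semidecidable_ex (E := fun y => E (y.2, y.1.2) /\ rat_lt y.1.1 y.2)).
    exact: effective_rat_name.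
  apply: semidecidable_and.
    by apply: (semidecidable_comp sE); computability.
  by apply: decidable_semidecidable; apply: decidable_rat_lt; computability.
have rat0 : rat_of R (0, 0, 0)%N = 0%R by rewrite /rat_of subrr mul0r.
move=> q; apply/seteqP; split => x /=.
  move=> /ereal_sup_gt[y [->|[q' [i [Eqi Bx ->]]]]] qy.
    have [i Bx] := cov x; exists i => //; left.
    by rewrite (rat_ltE R) rat0 -lte_fin.
  exists i => //; right; exists q'; split=> //.
  by rewrite (rat_ltE R) -lte_fin.
move=> [i [q0|[q' [Eqi qq']]] Bx].
  apply: lt_le_trans (sup_of_family_ge0 E x).
  by move: q0; rewrite (rat_ltE R) rat0 -lte_fin.
apply: lt_le_trans (sup_of_family_ub Eqi Bx).
by move: qq'; rewrite (rat_ltE R) -lte_fin.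
Qed.

Lemma lower_semicomputable_max f g :
  lower_semicomputable B f -> lower_semicomputable B g ->
  lower_semicomputable B (fun x => maxe (f x) (g x) : \bar R).
Proof.
move=> [f0 [E eE fE]] [g0 [F eF gF]]; split; first by move=> x; rewrite le_max f0.
exists (E `|` F).
  by apply: semidecidable_enumerable; apply: semidecidable_or;
    exact: enumerable_semidecidable.
move=> q; rewrite (_ : [set x | _] = [set x | (rat_of R q)%:E < f x] `|`
    [set x | (rat_of R q)%:E < g x]).
  rewrite fE gF; apply/seteqP; split => x /=.
    by move=> [[i Ei Bx]|[i Fi Bx]]; exists i => //; [left|right].
  by move=> [i [Ei|Fi] Bx]; [left|right]; exists i.
apply/seteqP; split => x /=; first by rewrite lt_max => /orP[]; [left|right].
by rewrite lt_max => -[->|->]; rewrite ?orbT.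
Qed.

Lemma lower_semicomputable_scale (k : nat) f : lower_semicomputable B f ->
  lower_semicomputable B (fun x => (k.+1%:R^-1)%:E * f x : \bar R).
Proof.
move=> [f0 [E eE fE]]; split; first by move=> x; rewrite mule_ge0.
pose s (q : rat_name) : rat_name := (q.1.1 * k.+1, q.1.2 * k.+1, q.2)%N.
have sE q : rat_of R (s q) = (k.+1%:R * rat_of R q)%R.
  by rewrite /rat_of /= !natrM -mulrBl mulrAC mulrC.
exists (fun x => E (s x.1, x.2)).
  apply: semidecidable_enumerable.
  apply: (semidecidable_comp (enumerable_semidecidable eE)).
  by rewrite /s; computability.
move=> q; rewrite -[RHS]/(\bigcup_(i in [set j | E (s q, j)]) B i) -fE.
apply/seteqP; split => x /=; rewrite sE EFinM.
  by rewrite -lte_pdivrMl// invrK.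
by rewrite lte_pdivlMl.
Qed.

End lower_semicomputable.

Section constructive_metric.
Variables (R : realType) (X : constructiveMetricType R).
Implicit Types (x y : X) (e : R).

Lemma open_metric_ball x e : open (ball x e).
Proof.
rewrite openE => y; rewrite ballEmdist /= => xy.
apply/nbhs_ballP; exists (e - mdist x y); first by rewrite /= subr_gt0.
move=> z; rewrite !ballEmdist /= ltrBrDl; apply: le_lt_trans.
exact: metric_triangle.
Qed.

Lemma ideal_point_near x e : 0 < e -> exists i, mdist (ideal_point i : X) x < e.
Proof.
move=> e0; have [||y [xy [i _ iy]]] := @ideal_point_dense R X (ball x e).
- by exists x; exact: ballxx.
- exact: open_metric_ball.
by exists i; rewrite iy metric_sym; move: xy; rewrite ballEmdist.
Qed.

Lemma basic_ballE (b : ball_name) x :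
  basic_ball b x = (mdist (ideal_point b.1) x < posrat_of R b.2) :> Prop.
Proof. by rewrite /basic_ball ballEmdist. Qed.

Lemma basic_ball_cover x : exists b : ball_name, basic_ball b x.
Proof.
have [i xi] := @ideal_point_near x 1 ltr01.
by exists (i, (0, 0)%N); rewrite basic_ballE /posrat_of /= divr1.
Qed.

Lemma measurable_lower_semicomputable1 (f : X -> \bar R) :
  (forall q, open [set x | ((rat_of R q)%:E < f x)%E]) ->
  @measurable_fun _ _ (borel X) (\bar R) [set: borel X] f.
Proof.
move=> fo; apply: (measurability _ (ErealGenOInfty.measurableE R)).
move=> /= _ [_ [a ->]] <-; apply: measurableI => //.
apply: sub_sigma_algebra; rewrite preimage_itvoy.
rewrite (_ : [set x | _] = \bigcup_(q in [set q | a < rat_of R q])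
    [set x | ((rat_of R q)%:E < f x)%E]).
  by apply: bigcup_open => q _; exact: fo.
apply/seteqP; split => x /=.
  by move=> /rat_of_dense_ereal[q [aq qf]]; exists q.
by move=> [q /= aq]; apply: lt_trans; rewrite lte_fin.
Qed.

Lemma lower_semicomputable1_measurable (f : X -> \bar R) :
  lower_semicomputable1 f -> @measurable_fun _ _ (borel X) (\bar R) [set: borel X] f.
Proof.
move=> [_ [E _ fE]]; apply: measurable_lower_semicomputable1 => q.
by rewrite fE; apply: bigcup_open => i _; exact: open_metric_ball.
Qed.

Lemma lower_semicomputable2_measurable (f : X -> measures X -> \bar R) P :
  lower_semicomputable2 f ->
  @measurable_fun _ _ (borel X) (\bar R) [set: borel X] (f ^~ P).
Proof.
move=> [_ [E _ fE]]; apply: measurable_lower_semicomputable1 => q.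
rewrite (_ : [set x | _] = \bigcup_(i in [set i | E (q, i) /\ basic_mball i.2 P])
    (basic_ball i.1 : set X)).
  by apply: bigcup_open => i _; exact: open_metric_ball.
apply/seteqP; split => x /=.
  move=> qf; have : [set xP : X * measures X | ((rat_of R q)%:E < f xP.1 xP.2)%E] (x, P).
    by [].
  by rewrite fE => -[i Ei [/= xi Pi]]; exists i.
move=> [i [Ei Pi] xi].
suff : [set xP : X * measures X | ((rat_of R q)%:E < f xP.1 xP.2)%E] (x, P) by [].
by rewrite fE; exists i.
Qed.

Lemma pow2V_lt e : 0 < e -> exists n, 2 ^- n < e.
Proof.
move=> e0; have := archi_boundP (ltW (divr_gt0 ltr01 e0)).
set n := Num.bound _ => en; exists n.
rewrite invf_plt ?posrE ?exprn_gt0// -div1r (lt_trans en)//.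
by rewrite -natrX ltr_nat ltn_expl.
Qed.

(* Formal inclusion: unlike inclusion of the balls themselves, it is semidecidable. *)
Definition dist_lt (b b' : ball_name) : Prop :=
  mdist (ideal_point b.1 : X) (ideal_point b'.1) + posrat_of R b.2 < posrat_of R b'.2.

Lemma semidecidable_dist_lt :
  semidecidable (fun b : ball_name * ball_name => dist_lt b.1 b.2).
Proof.
have [f rf fE] := @ideal_point_computable R X.
pose F (b : ball_name * ball_name) n := f [tuple b.1.1; b.2.1; n].
pose p (x : ball_name * ball_name * nat) :=
  (((F x.1 x.2).+1 * x.1.1.2.2.+1 + x.1.1.2.1.+1 * 2 ^ x.2) * x.1.2.2.2.+1
   < x.1.2.2.1.+1 * (2 ^ x.2 * x.1.1.2.2.+1))%N.
have pE b n : p (b, n) = ((F b n).+1%:R / 2 ^+ n + posrat_of R b.1.2 < posrat_of R b.2.2).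
  rewrite /p /posrat_of /= addf_div ?expf_neq0 ?pnatr_eq0//.
  rewrite ltr_pdivrMr ?mulr_gt0 ?exprn_gt0 ?ltr0n// mulrAC ltr_pdivlMr ?ltr0n//.
  by rewrite -natrX -!natrM -!natrD -!natrM ltr_nat.
exists p.
  have cF : computable (fun x : ball_name * ball_name * nat => F x.1 x.2).
    by apply: (computable_nat3 rf); computability.
  by rewrite /p; computability.
move=> b; rewrite /dist_lt; split=> [db|[n]].
  have /pow2V_lt[n] : 0 < (posrat_of R b.2.2 -
      (mdist (ideal_point b.1.1 : X) (ideal_point b.2.1) + posrat_of R b.1.2)) / 2.
    by rewrite divr_gt0// subr_gt0.
  move=> nlt; exists n; rewrite pE.
  have := fE b.1.1 b.2.1 n; rewrite -/(F b n) ler_distl => /andP[+ _].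
  rewrite -[(F b n).+1%:R]natr1 mulrDl mul1r; lra.
rewrite pE; have := fE b.1.1 b.2.1 n; rewrite -/(F b n) ler_distl => /andP[_].
rewrite -[(F b n).+1%:R]natr1 mulrDl mul1r; lra.
Qed.

Lemma dist_lt_sub b b' x : dist_lt b b' -> basic_ball b x -> basic_ball b' x.
Proof.
rewrite /dist_lt !basic_ballE => bb' bx.
have := metric_triangle (ideal_point b'.1) (ideal_point b.1) x.
by rewrite (metric_sym (ideal_point b'.1) (ideal_point b.1)); lra.
Qed.

Lemma basic_ball_refine (l : seq ball_name) x : (forall b, b \in l -> basic_ball b x) ->
  exists b0, basic_ball b0 x /\ forall b, b \in l -> dist_lt b0 b.
Proof.
move=> lx; have [e e0 le] : exists2 e : R, 0 < e & forall b, b \in l ->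
    mdist (ideal_point b.1) x + e <= posrat_of R b.2.
  elim: l lx => [|b l IH] lx; first by exists 1.
  have [|e e0 le] := IH; first by move=> c cl; apply: lx; rewrite inE cl orbT.
  have := lx b (mem_head _ _); rewrite basic_ballE => bx.
  exists (Num.min e (posrat_of R b.2 - mdist (ideal_point b.1) x)).
    by rewrite lt_min e0 subr_gt0.
  move=> c; rewrite inE -lerBrDl => /orP[/eqP->|/le]; first by rewrite ge_min lexx orbT.
  by rewrite -lerBrDl ge_min => ->.
have e2 : 0 < e / 2 by rewrite divr_gt0.
have [i ix] := ideal_point_near x e2.
have [r /andP[ir re]] := posrat_of_dense (mdist_ge0 _ _) ix.
exists (i, r); split; first by rewrite basic_ballE.
move=> b bl; rewrite /dist_lt /=; have := le _ bl.
have := metric_triangle (ideal_point i) x (ideal_point b.1).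
by rewrite (metric_sym x (ideal_point b.1)); lra.
Qed.

Lemma prokhorov_triangle (P Q S : measures X) :
  prokhorov P S <= prokhorov P Q + prokhorov Q S.
Proof.
apply/ler_addgt0Pl => /= e e0; apply: ltW.
have e2 : 0 < e / 2 by rewrite divr_gt0.
have := @ball_triangle _ _ Q P S (prokhorov P Q + e / 2) (prokhorov Q S + e / 2).
rewrite !measures_ballE /= !ltrDl e2 => /(_ isT isT).
by rewrite addrACA -splitr addrC.
Qed.

Lemma prokhorov_ge0 (P Q : measures X) : 0 <= prokhorov P Q.
Proof.
rewrite leNgt; apply/negP => /prokhorov_ltP[d [d0 _]].
by rewrite ltNge ltW.
Qed.

Lemma open_measures_ball (P : measures X) e : open (ball P e).
Proof.
rewrite openE => Q; rewrite measures_ballE /= => PQ.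
apply/nbhs_ballP; exists (e - prokhorov P Q); first by rewrite /= subr_gt0.
move=> S; rewrite !measures_ballE /= ltrBrDl; apply: le_lt_trans.
exact: prokhorov_triangle.
Qed.

Lemma prokhorov_same (P Q S : measures X) :
  same_measure P Q -> prokhorov S P = prokhorov S Q.
Proof.
move=> PQ; congr inf; apply/seteqP; split => e [e0 H]; split=> // A mA;
  have := H A mA; rewrite ?PQ//; exact: enlargement_measurable.
Qed.

Lemma same_measure_lower_semicomputable2 (f : X -> measures X -> \bar R) P Q x :
  lower_semicomputable2 f -> same_measure P Q -> f x P = f x Q.
Proof.
move=> lf; suff H S1 S2 : same_measure S1 S2 -> (f x S1 <= f x S2)%E.
  by move=> PQ; apply/eqP; rewrite eq_le !H// => A mA; rewrite PQ.
have [f0 [E _ fE]] := lf => S12.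
rewrite leNgt; apply/negP => flt.
have [r fr] : exists r : R, f x S2 = r%:E.
  have := f0 (x, S2); move: flt; case: (f x S2) => //= [r _|]; first by exists r.
  by rewrite ltNge leey.
move: flt; rewrite fr => /rat_of_dense_ereal[q [rq qf]].
have : [set xP : X * measures X | ((rat_of R q)%:E < f xP.1 xP.2)%E] (x, S1) by [].
rewrite fE => -[i Ei [ix iS]].
have : [set xP : X * measures X | ((rat_of R q)%:E < f xP.1 xP.2)%E] (x, S2).
  rewrite fE; exists i => //; split=> //.
  by move: iS; rewrite /basic_mball !measures_ballE /= (prokhorov_same _ S12).
by rewrite /= fr lte_fin ltNge ltW.
Qed.

End constructive_metric.

(** * Infima over an effectively compact class *)

Section class_infimum.
Variables (R : realType) (X : constructiveMetricType R) (C : set (measures X)).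
Hypothesis Ceff : effectively_compact C.
Local Open Scope ereal_scope.

Lemma effectively_compact_subcover (I : choiceType) (D : set I) (f : I -> mball_name) :
  C `<=` \bigcup_(i in D) basic_mball (f i) ->
  exists2 l : seq I, {in l, forall i, D i} &
    C `<=` \bigcup_(m in [set m | m \in map f l]) basic_mball m.
Proof.
have [Ccpt _] := Ceff; move: Ccpt; rewrite compact_cover => Ccpt.
move=> /(Ccpt I D (fun i => basic_mball (f i)))[i _|D' D'D CD'].
  exact: open_measures_ball.
exists (finmap.enum_fset D') => [i /D'D|P /CD'[i /= iD' Pi]]; first by rewrite inE.
by exists (f i) => //=; apply/mapP; exists i.
Qed.

(* u x is the infimum of h x Q over Q in C; that it exceeds q is witnessed by a finite
   cover of C by balls m such that h > q on b * m for some b containing x. *)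
Lemma lower_semicomputable_class_inf (h : X -> measures X -> \bar R) :
  lower_semicomputable2 h ->
  exists u : X -> \bar R, [/\ lower_semicomputable1 u,
    forall x P, C P -> u x <= h x P &
    forall x y, (forall Q, C Q -> y <= h x Q) -> y <= u x].
Proof.
move=> [h0 [E enumE hE]].
pose cov (c : seq mball_name) := C `<=` \bigcup_(m in [set m | m \in c]) basic_mball m.
pose Em (z : (rat_name * ball_name) * mball_name) :=
  exists b', E (z.1.1, (b', z.2)) /\ dist_lt X z.1.2 b'.
pose E0 (z : rat_name * ball_name) := exists c, cov c /\ forall m, m \in c -> Em (z, m).
have sE0 : semidecidable E0.
  apply: (semidecidable_ex (E := fun y => cov y.2 /\ forall m, m \in y.2 -> Em (y.1, m))).
    repeat (apply: effective_seq || apply: effective_pair || exact: effective_nat).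
  apply: semidecidable_and.
    apply: (semidecidable_comp (E := cov)); last by computability.
    exact: enumerable_semidecidable Ceff.2.
  apply: (semidecidable_all ([::], (0, 0)%N) (E := fun y => Em (y.1.1, y.2))).
    by computability.
  apply: (semidecidable_ex (E := fun y => E (y.1.1.1.1, (y.2, y.1.2)) /\
      dist_lt X y.1.1.1.2 y.2)).
    repeat (apply: effective_pair || exact: effective_nat).
  apply: semidecidable_and.
    apply: (semidecidable_comp (enumerable_semidecidable enumE)).
    by computability.
  apply: (semidecidable_comp (f := fun y => (y.1.1.1.2, y.2))
    (semidecidable_dist_lt X)).
  by computability.
exists (sup_of_family R (@basic_ball R X) E0); split.
- apply: lower_semicomputable_sup_of_family => //; exact: basic_ball_cover.
- move=> x P CP; apply: ge_ereal_sup => y [->|[q [b [[c [/(_ _ CP)[m /= mc Pm] Ec]] bx ->]]]].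
    exact: h0 (x, P).
  have [b' [Eb' bb']] := Ec _ mc; apply: ltW.
  have : [set xP | (rat_of R q)%:E < h xP.1 xP.2] (x, P); last by [].
  by rewrite hE; exists (b', m) => //; split=> //=; exact: dist_lt_sub bb' bx.
- move=> x y Hy; rewrite leNgt; apply/negP => uy.
  have [r ur] : exists r : R, sup_of_family R (@basic_ball R X) E0 x = r%:E.
    have := sup_of_family_ge0 R (@basic_ball R X) E0 x; move: uy.
    case: (sup_of_family _ _ _ x) => //= [r _ _|]; first by exists r.
    by rewrite ltNge leey.
  move: (uy); rewrite ur => /rat_of_dense_ereal[q [rq qy]].
  have [|l lE lC] := @effectively_compact_subcover _
    [set i : ball_name * mball_name | E (q, i) /\ basic_ball i.1 x] snd.
    move=> P CP; have : [set xP | (rat_of R q)%:E < h xP.1 xP.2] (x, P).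
      exact: lt_le_trans qy (Hy _ CP).
    by rewrite hE => -[i Ei [ix iP]]; exists i.
  have [b|b0 [b0x Hb0]] := @basic_ball_refine R X (map fst l) x.
    by move=> /mapP[i /lE[_ ix] ->].
  have : (rat_of R q)%:E <= sup_of_family R (@basic_ball R X) E0 x.
    apply: (sup_of_family_ub R _ b0x); exists (map snd l); split=> // m /mapP[i il ->].
    exists i.1; split; first by have [+ _] := lE _ il; case: (i).
    by apply: Hb0; apply/mapP; exists i.
  by rewrite ur lee_fin leNgt rq.
Qed.

End class_infimum.

(** * Density of the ideal measures *)

Section ideal_measures.
Variables (R : realType) (X : constructiveMetricType R).
Implicit Types (P Q : measures X) (s : ideal_measure_name).

Definition total_weight s : nat := (\sum_(cw <- s) cw.2)%N.

Definition mass (p : nat -> bool) s : nat := (\sum_(cw <- s) cw.2 * p cw.1)%N.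

Lemma ideal_measureE s (A : set (borel X)) : (0 < total_weight s)%N ->
  ideal_measure X s A =
  ((mass (fun c => (ideal_point c : borel X) \in A) s)%:R / (total_weight s)%:R)%:E.
Proof.
move=> s0; rewrite /ideal_measure; set m := msum _ _.
have mE B : m B = ((mass (fun c => (ideal_point c : borel X) \in B) s)%:R)%:E.
  rewrite /m /msum /mass (big_nth (0, 0)%N) big_mkord natr_sum -sumEFin.
  by apply: eq_bigr => k _; rewrite natrM EFinM; congr (_ * _)%E; exact: diracE.
have mT : m setT = (total_weight s)%:R%:E.
  rewrite mE; congr (_%:R%:E); apply: eq_bigr => cw _.
  by rewrite in_setT muln1.
rewrite -[LHS]/((if (m setT == 0) || (m setT == +oo)%E
  then fun U => \d_(ideal_point 0%N : borel X) U
  else fun U => m U * (fine (m setT))^-1%:E)%E A).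
rewrite mT /=.
rewrite eqe pnatr_eq0 -leqn0 leqNgt s0 /=.
by rewrite mE -EFinM.
Qed.

Lemma prokhorov_sym P Q : prokhorov P Q = prokhorov Q P.
Proof.
by congr inf; apply/seteqP; split => e; exact: prokhorov_close_sym.
Qed.

Lemma prokhorov_close_half P Q e : 0 < e ->
  (forall A : set (borel X), measurable A -> (P A <= Q (enlargement A e) + e%:E)%E) ->
  prokhorov_close P Q e.
Proof.
move=> e0 PQ; split=> // A mA; split; first exact: PQ.
have mAe := enlargement_measurable A e0.
have mB : measurable (~` enlargement A e : set (borel X)) by exact: measurableC.
have mBe := enlargement_measurable (~` enlargement A e) e0.
have QA : (Q (enlargement (~` enlargement A e) e) <= 1 - Q A)%E.
  rewrite -probability_setC//; apply: le_measure; rewrite ?inE//.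
    exact: measurableC.
  move=> y [x /= nx xy] Ay; apply: nx; exists y => //; exact: ball_sym.
have := PQ _ mB; rewrite probability_setC// => /le_trans /(_ (leeD2r _ QA)).
rewrite -(fineK (fin_num_measure P _ mAe)) -(fineK (fin_num_measure Q _ mA)).
by rewrite -!EFinB -!EFinD !lee_fin; lra.
Qed.

Lemma mass_cat p s1 s2 : mass p (s1 ++ s2) = (mass p s1 + mass p s2)%N.
Proof. by rewrite /mass big_cat. Qed.

Lemma ideal_measure_near P e : 0 < e ->
  exists s, (0 < total_weight s)%N /\ prokhorov (ideal_measure X s) P < e.
Proof.
move=> e0; pose r := e / 3; have r0 : 0 < r by rewrite divr_gt0.
pose B k : set (borel X) := ball (ideal_point k : X) r.
have mB k : measurable (B k) by apply: sub_sigma_algebra; exact: open_metric_ball.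
pose A := seqDU B.
have mA k : measurable (A k) by exact: seqDU_measurable.
have BT : \bigcup_k B k = setT.
  rewrite -subTset => x _; have [i ix] := @ideal_point_near R X x r r0.
  by exists i => //; rewrite /B /= ballEmdist.
pose U n := \big[setU/set0]_(k < n) B k.
have mU n : measurable (U n) by exact: bigsetU_measurable.
have [n Un] : exists n, 1 - r < fine (P (U n)).
  have UT : \bigcup_n U n = setT.
    rewrite -BT eqEsubset; split => x [k _].
      by rewrite /U -bigcup_mkord => -[i _ Bi]; exists i.
    by move=> Bx; exists k.+1 => //; rewrite /U big_ord_recr; right.
  have cv : (fine \o (P \o U)) n @[n --> \oo] --> (1 : R).
    apply: fine_cvg; rewrite -(probability_setT P) -UT.
    apply: nondecreasing_cvg_mu => //; first by rewrite UT.
    by move=> m k mk; apply/subsetPset; exact: subset_bigsetU.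
  have [|n _ /(_ n (leqnn n))] := @cvgr_gt _ _ _ _ _ _ cv (1 - r).
    by rewrite ltrBlDr ltrDl.
  by exists n.
pose p k := fine (P (A k)).
have pE k : P (A k) = (p k)%:E by rewrite fineK// fin_num_measure.
have p_ge0 k : 0 <= p k by rewrite -lee_fin -pE.
have UE : U n = \big[setU/set0]_(k < n) A k by rewrite /U bigsetU_seqDU.
have PU : P (U n) = (\sum_(k < n) p k)%:E.
  rewrite UE [LHS]measure_bigsetU//; last exact: trivIset_seqDU.
  by rewrite -sumEFin; apply: eq_bigr => k _; exact: pE.
have sump : \sum_(k < n) p k = fine (P (U n)) by rewrite PU.
pose M := (Num.truncn (n%:R / r)).+1.
have M0 : 0 < M%:R :> R by rewrite ltr0n.
have nM : n%:R / M%:R <= r.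
  rewrite ler_pdivrMr// mulrC -ler_pdivrMr//; exact/ltW/truncnS_gt.
pose w k := Num.truncn (M%:R * p k).
have wM : (\sum_(k < n) w k <= M)%N.
  rewrite -(ler_nat R) natr_sum; apply: (@le_trans _ _ (\sum_(k < n) M%:R * p k)).
    by apply: ler_sum => k _; rewrite truncn_le mulr_ge0// ltW.
  rewrite -mulr_sumr sump ler_piMr ?(ltW M0)// -lee_fin fineK ?fin_num_measure//.
  exact: probability_le1.
pose s0 := [seq (k, w k) | k <- iota 0 n].
pose s : ideal_measure_name := s0 ++ [:: (0, M - \sum_(k < n) w k)]%N.
have sM : total_weight s = M.
  rewrite /total_weight /s big_cat big_seq1 /s0 big_map /= -[n in iota _ n]subn0.
  by rewrite -/(index_iota 0 n) big_mkord subnKC.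
exists s; split; first by rewrite sM.
rewrite prokhorov_sym; apply/prokhorov_ltP; exists (2 * r); last by rewrite /r; lra.
apply: prokhorov_close_half; first by rewrite mulr_gt0.
move=> D mD; rewrite ideal_measureE ?sM//.
set De := enlargement _ _.
have PD : (P D <= (\sum_(k < n) p k * ((ideal_point k : borel X) \in De)%:R + r)%:E)%E.
  rewrite (measureDI P mD (mU n)) addeC EFinD; apply: leeD.
    rewrite (_ : D `&` _ = \big[setU/set0]_(k < n) (D `&` A k)); last first.
      by rewrite UE -bigcup_mkord setI_bigcupr bigcup_mkord.
    have mDA k : measurable (D `&` A k) by exact: measurableI.
    have tDA : trivIset setT (fun k => D `&` A k).
      by apply: trivIset_setIl; exact: trivIset_seqDU.
    rewrite [leLHS](measure_bigsetU P mDA tDA).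
    rewrite -sumEFin; apply: lee_sum => k _.
    case: (pselect (exists x, (D `&` A k) x)) => [[x [Dx Akx]]|D0]; last first.
      rewrite (_ : D `&` A k = set0) ?measure0 ?lee_fin ?mulr_ge0//.
      by rewrite -subset0 => x Dx; apply: D0; exists x.
    have -> : (ideal_point k : borel X) \in De.
      rewrite inE; exists x => //; apply: ball_sym.
      apply: (@le_ball _ _ _ r); first by rewrite ler_peMl ?ler1n// ltW.
      exact: subset_seqDU Akx.
    rewrite mulr1 -pE; apply: le_measure; rewrite ?inE//.
  apply: (@le_trans _ _ (P (~` U n))).
    by apply: le_measure; rewrite ?inE; [exact: measurableD|exact: measurableC|move=> x []].
  rewrite probability_setC//.
  by rewrite PU -EFinB lee_fin; move: Un; rewrite PU /=; lra.
apply: (le_trans PD); rewrite -EFinD lee_fin [2 * r]mulr_natl mulr2n addrA lerD2r.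
apply: (@le_trans _ _ ((mass (fun c => (ideal_point c : borel X) \in De) s0)%:R / M%:R
    + n%:R / M%:R)); last first.
  by rewrite lerD// ler_pM2r ?invr_gt0// ler_nat /s mass_cat leq_addr.
rewrite /mass /s0 big_map -[n in iota _ n]subn0 -/(index_iota 0 n) big_mkord.
rewrite -mulrDl natr_sum -[n%:R]mulr1n -[n in n%:R]card_ord -sumr_const -big_split /=.
rewrite mulr_suml; apply: ler_sum => k _.
rewrite ler_pdivlMr// natrM mulrAC.
case: (_ \in _); rewrite ?mulr0 ?add0r ?mulr1 //.
by rewrite mulrC ltW// natr1 truncnS_gt.
Qed.

End ideal_measures.

(** * Trimming a class test to a uniform test *)

Section trimming.
Variables (R : realType) (X : constructiveMetricType R) (f : X -> \bar R).
Variables (item : nat -> nat * ball_name) (valid : nat -> bool).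
Hypothesis citem : computable item.
Hypothesis cvalid : decidable_pred valid.
Hypothesis f_ge0 : forall x, (0 <= f x)%E.
Hypothesis itemP : forall n x, ((2 ^+ n)%:E < f x)%E <->
  exists k, [/\ valid k, (item k).1 = n & basic_ball (item k).2 x].
Variable F : nat * nat * nat -> nat.
Hypothesis cF : computable F.
Hypothesis FE : forall i j n,
  `|mdist (ideal_point i : X) (ideal_point j) - (F (i, j, n))%:R / 2 ^+ n| <= 2 ^- n.

(* Valid items enumerate the balls of the level sets {f > 2^n}.  At stage i only the first
   i of them are used; [inner_level] shrinks them by 2^-i, and [near_level] is a decidable
   test on ideal points which holds on the 2^-(i+1)-enlargement of [inner_level] and whose
   2^-(i+3)-enlargement is contained in {f > 2^n}.  The sums of 2^n over n < i with
   f x > 2^n approximate f x within a factor 2; stage i is open at Q when some ideal measure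
   close to Q gives such a sum, computed with [near_level], an integral at most 3. *)
Definition near_level (n i c : nat) : bool :=
  [exists k : 'I_i, [&& valid k, (item k).1 == n &
    (F (c, (item k).2.1, i + 3) + 2) * (item k).2.2.2.+1
      <= (item k).2.2.1.+1 * 2 ^ (i + 3)]]%N.

Definition light (i : nat) (s : ideal_measure_name) : bool :=
  ((0 < total_weight s) && (\sum_(n < i) 2 ^ n * mass (near_level n i) s <= 3 * total_weight s))%N.

Definition small_radius (i : nat) (e : posrat_name) : bool :=
  (e.1.+1 * 2 ^ i.+1 <= e.2.+1)%N.

Definition stage_open (i : nat) (Q : measures X) : Prop :=
  exists m : mball_name, [/\ light i m.1, small_radius i m.2 & basic_mball m Q].

Definition inner_level (n i : nat) : set X := [set x | exists k,
  [/\ (k < i)%N, valid k, (item k).1 = n &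
    mdist (ideal_point (item k).2.1) x + 2 ^- i < posrat_of R (item k).2.2]].

Definition stage_fun (i : nat) (x : X) : \bar R :=
  (\sum_(n < i) (2 ^+ n)%:E * (\1_(inner_level n i) x)%:E)%E.

Lemma small_radiusE i e : small_radius i e = (posrat_of R e <= 2 ^- i.+1).
Proof.
rewrite /small_radius /posrat_of ler_pdivrMr ?ltr0n// mulrC ler_pdivlMr ?exprn_gt0//.
by rewrite -natrX -natrM ler_nat.
Qed.

Lemma half_powE i : (2 ^- i = 8 * 2 ^- (i + 3) :> R) /\ (2 ^- i.+1 = 4 * 2 ^- (i + 3) :> R).
Proof.
have ? : (2 ^+ i : R) != 0 by rewrite expf_neq0.
by rewrite addn3 !exprS; split; field.
Qed.

Lemma near_levelP n i c : reflect
  (exists k, [/\ (k < i)%N, valid k, (item k).1 = n &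
    (F (c, (item k).2.1, (i + 3)%N))%:R / 2 ^+ (i + 3) + 2 * 2 ^- (i + 3)
      <= posrat_of R (item k).2.2])
  (near_level n i c).
Proof.
have E k : ((F (c, (item k).2.1, i + 3) + 2) * (item k).2.2.2.+1
      <= (item k).2.2.1.+1 * 2 ^ (i + 3))%N =
    ((F (c, (item k).2.1, (i + 3)%N))%:R / 2 ^+ (i + 3) + 2 * 2 ^- (i + 3)
      <= posrat_of R (item k).2.2).
  rewrite -mulrDl /posrat_of ler_pdivrMr ?exprn_gt0// mulrAC ler_pdivlMr ?ltr0n//.
  by rewrite -natrX -natrD -!natrM ler_nat.
apply: (iffP existsP) => [[k /and3P[vk /eqP nk]]|[k [ki vk nk]]].
  by rewrite E => kE; exists k.
by rewrite -E => kE; exists (Ordinal ki); rewrite /= vk nk eqxx.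
Qed.

Lemma inner_level_near n i c d : d < 2 ^- i.+1 ->
  enlargement (inner_level n i) d (ideal_point c) -> near_level n i c.
Proof.
move=> di [x [k [ki vk nk]]]; rewrite ballEmdist /= => kx xc.
apply/near_levelP; exists k; split=> //.
have := FE c (item k).2.1 (i + 3)%N; rewrite ler_distl => /andP[+ _].
have := metric_triangle (ideal_point (item k).2.1) x (ideal_point c).
rewrite (metric_sym (ideal_point c)).
have [E8 E4] := half_powE i; move: kx di; rewrite E8 E4.
have : 0 < 2 ^- (i + 3) :> R by rewrite invr_gt0 exprn_gt0.
by lra.
Qed.

Lemma near_level_sub n i c x : near_level n i c ->
  mdist (ideal_point c) x < 2 ^- (i + 3) -> ((2 ^+ n)%:E < f x)%E.
Proof.
move=> /near_levelP[k [ki vk nk kE]] cx; apply/itemP; exists k; split=> //.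
rewrite basic_ballE.
have := FE c (item k).2.1 (i + 3)%N; rewrite ler_distl => /andP[_].
have := metric_triangle (ideal_point (item k).2.1) (ideal_point c) x.
rewrite (metric_sym (ideal_point (item k).2.1) (ideal_point c)).
by move: kE cx; lra.
Qed.

Lemma inner_level_mono n i j : (i <= j)%N -> inner_level n i `<=` inner_level n j.
Proof.
move=> ij x [k [ki vk nk kx]]; exists k; split=> //; first exact: leq_trans ij.
apply: le_lt_trans kx; rewrite lerD2l lef_pV2 ?posrE ?exprn_gt0//.
by rewrite ler_eXn2l ?ltr1n.
Qed.

Lemma open_inner_level n i : open (inner_level n i).
Proof.
rewrite (_ : inner_level n i = \bigcup_(k in [set k | [/\ (k < i)%N, valid k & (item k).1 = n]])
   ball (ideal_point (item k).2.1 : X) (posrat_of R (item k).2.2 - 2 ^- i)).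
  by apply: bigcup_open => k _; exact: open_metric_ball.
apply/seteqP; split => x /=.
  by move=> [k [ki vk nk kx]]; exists k => //; rewrite ballEmdist /= ltrBrDr.
by move=> [k [ki vk nk]]; rewrite ballEmdist /= ltrBrDr => kx; exists k.
Qed.

Lemma measurable_inner_level n i : measurable (inner_level n i : set (borel X)).
Proof. by apply: sub_sigma_algebra; exact: open_inner_level. Qed.

Local Open Scope ereal_scope.

Lemma stage_fun_ge0 i x : 0 <= stage_fun i x.
Proof. by apply: sume_ge0 => n _; rewrite mule_ge0// lee_fin ?exprn_ge0. Qed.

Lemma stage_fun_mono i j x : (i <= j)%N -> stage_fun i x <= stage_fun j x.
Proof.
move=> ij; rewrite /stage_fun (big_ord_widen _ (fun n => (2 ^+ n)%:E *
  (\1_(inner_level n i) x)%:E) ij) big_mkcond /=; apply: lee_sum => n _.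
case: ifP => _; last by rewrite mule_ge0// lee_fin ?exprn_ge0.
rewrite lee_wpmul2l// ?lee_fin ?exprn_ge0// !indicE ler_nat.
have [xi|//] := boolP (x \in inner_level n i).
by rewrite (mem_set (inner_level_mono ij (set_mem xi))).
Qed.

Lemma measurable_stage_fun i :
  @measurable_fun _ _ (borel X) (\bar R) [set: borel X] (stage_fun i).
Proof.
apply: emeasurable_sum => n; apply: measurable_funeM.
by apply/measurable_EFinP/measurable_indic; exact: measurable_inner_level.
Qed.

Lemma integral_dyadic_sum (Q : measures X) (A : nat -> set (borel X)) i :
  (forall n, measurable (A n)) ->
  \int[Q]_(x in [set: borel X]) (\sum_(n < i) (2 ^+ n)%:E * (\1_(A n) x)%:E) =
  (\sum_(n < i) 2 ^+ n * fine (Q (A n)))%:E.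
Proof.
move=> mA; rewrite ge0_integral_sum//; last first.
  by move=> n; apply: measurable_funeM; apply/measurable_EFinP/measurable_indic.
rewrite -sumEFin; apply: eq_bigr => n _.
rewrite ge0_integralZl_EFin ?exprn_ge0//; last first.
  by apply/measurable_EFinP/measurable_indic.
by rewrite integral_indic// setIT EFinM fineK// fin_num_measure.
Qed.

Lemma sum_pow2 i : (\sum_(n < i) 2 ^+ n <= 2 ^+ i :> R)%R.
Proof.
elim: i => [|i IH]; first by rewrite big_ord0 expr0.
by rewrite big_ord_recr /= exprS mulr_natl mulr2n lerD2r.
Qed.

Lemma integral_stage_fun i (Q : measures X) : stage_open i Q ->
  \int[Q]_(x in [set: borel X]) stage_fun i x <= 4%:E.
Proof.
move=> [[s e] [/= /andP[s0 ls]]]; rewrite small_radiusE /basic_mball measures_ballE /=.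
move=> ei /prokhorov_ltP[d [d0 dQ] de].
rewrite [leLHS](@integral_dyadic_sum Q (inner_level ^~ i)); last first.
  by move=> n; exact: measurable_inner_level.
rewrite lee_fin.
have T0 : (0 < (total_weight s)%:R :> R)%R by rewrite ltr0n.
apply: (@le_trans _ _ (\sum_(n < i) 2 ^+ n * ((mass (near_level n i) s)%:R / (total_weight s)%:R + d))%R).
  apply: ler_sum => n _; rewrite ler_wpM2l ?exprn_ge0//.
  have mV := measurable_inner_level n i.
  have [_] := dQ _ mV; rewrite ideal_measureE// -EFinD.
  rewrite -(fineK (fin_num_measure Q _ mV)) lee_fin => /le_trans; apply.
  rewrite lerD2r ler_pM2r ?invr_gt0// ler_nat; apply: leq_sum => cw _.
  rewrite leq_mul2l; apply/orP; right.
  case: (boolP (_ \in _)) => // /set_mem /inner_level_near -> //.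
  exact: lt_le_trans ei.
under eq_bigr do rewrite mulrDr mulrA; rewrite big_split /= -!mulr_suml.
have -> : (4 = 3 + 1 :> R)%R by rewrite natr1.
apply: lerD.
  rewrite ler_pdivrMr//; move: ls; rewrite -(ler_nat R) natrM natr_sum.
  by under eq_bigr do rewrite natrM natrX.
apply: (@le_trans _ _ (2 ^+ i * 2 ^- i.+1)%R).
  by apply: ler_pM; rewrite ?sumr_ge0 ?sum_pow2 ?(ltW d0)// (le_trans (ltW de)).
by rewrite exprS invfM mulrCA divff ?expf_neq0// mulr1 invf_le1 ?ler1n.
Qed.

Definition level (n : nat) : set X := [set x | (2 ^+ n)%:E < f x].

Lemma dyadic_sum_le (x : X) i :
  \sum_(n < i) (2 ^+ n)%:E * (\1_(level n) x)%:E <= 2%:E * f x.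
Proof.
have := f_ge0 x; case fx : (f x) => [r| |//]; last first.
  by move=> _; rewrite gt0_muley ?leey// lte_fin.
rewrite lee_fin => r0; under eq_bigr do rewrite -EFinM; rewrite sumEFin -EFinM lee_fin.
have E n : (\1_(level n) x = ((2 ^+ n < r)%R)%:R :> R)%R.
  by rewrite indicE -lte_fin -fx; congr (nat_of_bool _)%:R; apply/idP/idP; rewrite inE.
under eq_bigr do rewrite E; elim: i => [|i IH]; first by rewrite big_ord0 mulr_ge0.
rewrite big_ord_recr /=; case: (ltrP (2 ^+ i) r) => ri; last by rewrite mulr0 addr0.
rewrite mulr1 mulr_natl mulr2n lerD// ?(ltW ri)// (le_trans _ (ltW ri))//.
apply: le_trans (sum_pow2 i); apply: ler_sum => n _.
by rewrite ler_piMr ?exprn_ge0// lern1 leq_b1.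
Qed.

Lemma stage_open_class (P : measures X) :
  (forall n, measurable (level n : set (borel X))) ->
  @measurable_fun _ _ (borel X) (\bar R) [set: borel X] f ->
  \int[P]_(x in [set: borel X]) f x <= 1 -> forall i, stage_open i P.
Proof.
move=> mL mf intf i; pose t : R := (2 ^- (i + 3) / 2)%R.
have p0 : (0 < 2 ^- (i + 3) :> R)%R by rewrite invr_gt0 exprn_gt0.
have t0 : (0 < t)%R by rewrite divr_gt0.
have [s [s0 sP]] := ideal_measure_near P t0.
have [e /andP[se et]] := posrat_of_dense (prokhorov_ge0 _ _) sP.
exists (s, e); split=> /=; last 2 first.
- rewrite small_radiusE; have [_ ->] := half_powE i; apply: ltW; apply: (lt_trans et).
  by rewrite /t; lra.
- by rewrite /basic_mball measures_ballE.
have /prokhorov_ltP[d [d0 dP] de] := se.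
have T0 : (0 < (total_weight s)%:R :> R)%R by rewrite ltr0n.
rewrite /light s0 /= -(ler_nat R) natrM natr_sum -ler_pdivrMr// mulr_suml.
have -> : (3%:R = 2 + 1 :> R)%R by rewrite natr1.
pose L n : set (borel X) := level n.
apply: (@le_trans _ _ (\sum_(n < i) 2 ^+ n * (fine (P (L n)) + t))%R).
  apply: ler_sum => n _; rewrite natrM natrX -mulrA ler_wpM2l ?exprn_ge0//.
  pose A : set X := enlargement [set ideal_point c | c in near_level n i] t.
  have mA : measurable (A : set (borel X)) by exact: enlargement_measurable.
  have [+ _] := dP _ mA; rewrite ideal_measureE// => sA.
  rewrite -lee_fin; apply: (@le_trans _ _ (P (enlargement A d) + d%:E)).
    apply: le_trans sA; rewrite lee_fin ler_pM2r ?invr_gt0// ler_nat.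
    apply: leq_sum => cw _; rewrite leq_mul2l; apply/orP; right.
    case: (boolP (near_level _ _ _)) => // nc; rewrite mem_set//.
    by exists (ideal_point cw.1); [exists cw.1|exact: ballxx].
  rewrite EFinD fineK ?fin_num_measure//; apply: leeD; last first.
    by rewrite lee_fin ltW// (lt_trans de).
  apply: le_measure; rewrite ?inE//; first exact: enlargement_measurable.
  move=> y /enlargementD[_ [c nc <-]]; rewrite ballEmdist /= => cy.
  apply: near_level_sub nc _; apply: lt_le_trans cy _.
  by move: de et; rewrite /t; lra.
under eq_bigr do rewrite mulrDr; rewrite big_split /= -!mulr_suml; apply: lerD.
  rewrite -lee_fin -(integral_dyadic_sum P i mL).
  apply: (@le_trans _ _ (\int[P]_(x in [set: borel X]) (2%:E * f x))).
    apply: ge0_le_integral => //.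
    - by move=> x _; apply: sume_ge0 => n _; rewrite mule_ge0// lee_fin ?exprn_ge0.
    - apply: emeasurable_sum => n; apply: measurable_funeM.
      by apply/measurable_EFinP/measurable_indic; exact: mL.
    - exact: measurable_funeM.
    - by move=> x _; exact: dyadic_sum_le.
  rewrite ge0_integralZl_EFin//.
  by rewrite -[leRHS]mule1 lee_wpmul2l ?lee_fin.
apply: (@le_trans _ _ (2 ^+ i * t)%R); first by rewrite ler_wpM2r ?(ltW t0) ?sum_pow2.
rewrite /t addn3 !exprS !invfM.
have : (2 ^+ i * (2 ^+ i)^-1 = 1 :> R)%R by rewrite divff// expf_neq0.
by move: (2 ^+ i)%R ((2 ^+ i)^-1)%R => a b ab; lra.
Qed.

(* The largest [stage_fun i x] over the stages i < j open at Q: stage functions increase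
   with the stage, so the last open stage wins. *)
Fixpoint last_stage (Q : measures X) (j : nat) (x : X) : \bar R :=
  if j is j'.+1 then
    if `[<stage_open j' Q>] then stage_fun j' x else last_stage Q j' x
  else 0.

Lemma last_stage_ge0 Q j x : 0 <= last_stage Q j x.
Proof. by elim: j => //= j IH; case: ifP => // _; exact: stage_fun_ge0. Qed.

Lemma last_stage_le Q j x : last_stage Q j x <= stage_fun j x.
Proof.
elim: j => /= [|j IH]; first exact: stage_fun_ge0.
case: ifP => _; first exact: stage_fun_mono.
by apply: le_trans IH _; exact: stage_fun_mono.
Qed.

Lemma last_stage_mono Q x : nondecreasing_seq (last_stage Q ^~ x).
Proof.
apply/nondecreasing_seqP => j /=; case: ifP => // _; exact: last_stage_le.
Qed.

Lemma measurable_last_stage Q j :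
  @measurable_fun _ _ (borel X) (\bar R) [set: borel X] (last_stage Q j).
Proof.
elim: j => [|j IH]; first exact: measurable_cst.
by rewrite /=; case: `[<_>] => //; exact: measurable_stage_fun.
Qed.

Lemma integral_last_stage (Q : measures X) j : \int[Q]_(x in [set: borel X]) last_stage Q j x <= 4%:E.
Proof.
elim: j => [|j IH] /=; first by rewrite integral0.
by case: asboolP => // Qj; exact: integral_stage_fun.
Qed.

Definition trim_ok (z : (rat_name * (ball_name * mball_name)) * (nat * nat)) : bool :=
  let: (q, (b, m), (i, k)) := z in
  [&& (k < i)%N, valid k, ((item k).1 < i)%N, q == (2 ^ (item k).1, 0, 0)%N,
    b.1 == (item k).2.1,
    ((b.2.1.+1 * 2 ^ i + b.2.2.+1) * (item k).2.2.2.+1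
      <= (item k).2.2.1.+1 * (b.2.2.+1 * 2 ^ i))%N,
    small_radius i m.2 & light i m.1].

Definition trimmed_family (z : rat_name * (ball_name * mball_name)) : Prop :=
  z.1 = (1, 0, 0)%N \/ exists y, trim_ok (z, y).

Definition trimmed (x : X) (Q : measures X) : \bar R :=
  sup_of_family R (@basic_prod R X) trimmed_family (x, Q).

Lemma decidable_light : decidable_pred (fun y : nat * ideal_measure_name => light y.1 y.2).
Proof.
have cnear : decidable_pred (fun y : nat * nat * nat => near_level y.1.1 y.1.2 y.2).
  apply: (decidable_exists (p := fun z : nat * nat * nat * nat =>
    [&& valid z.2, (item z.2).1 == z.1.1.1 &
     (F (z.1.2, (item z.2).2.1, z.1.1.2 + 3) + 2) * (item z.2).2.2.2.+1
      <= (item z.2).2.2.1.+1 * 2 ^ (z.1.1.2 + 3)]%N)); last by computability.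
  have c2 : computable (fun z : nat * nat * nat * nat => item z.2).
    by apply: (computable_comp citem); computability.
  computability.
    by apply: (decidable_comp cvalid); computability.
  by apply: (computable_comp cF); computability.
rewrite /light /total_weight /mass; computability.
- apply: (computable_sumseq (0, 0)%N
    (F := fun z : nat * ideal_measure_name * (nat * nat) => z.2.2)); computability.
- apply: (computable_sum (F := fun z : nat * ideal_measure_name * nat => (2 ^ z.2 *
    \sum_(cw <- z.1.2) cw.2 * near_level z.2 z.1.1 cw.1)%N)); computability.
  apply: (computable_sumseq (0, 0)%N (F := fun u : nat * ideal_measure_name * nat * (nat * nat) =>
    u.2.2 * near_level u.1.2 u.1.1.1 u.2.1)%N); computability.
  by apply: (decidable_comp (f := fun u => (u.1.2, u.1.1.1, u.2.1)) cnear); computability.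
- apply: (computable_sumseq (0, 0)%N
    (F := fun z : nat * ideal_measure_name * (nat * nat) => z.2.2)); computability.
Qed.

Lemma semidecidable_trimmed_family : semidecidable trimmed_family.
Proof.
apply: semidecidable_or.
  apply: (semidecidable_ext (E := fun z : rat_name * (ball_name * mball_name) =>
    z.1 == (1, 0, 0)%N)); first by move=> z; split=> /eqP.
  by apply: decidable_semidecidable; computability.
apply: (semidecidable_ex (E := fun z => trim_ok z)); first by apply: effective_pair; exact: effective_nat.
apply: decidable_semidecidable.
pose A := ((rat_name * (ball_name * mball_name)) * (nat * nat))%type.
have ck : computable (fun z : A => item z.2.2).
  by apply: (computable_comp citem); computability.
rewrite (_ : trim_ok = fun z : A => [&& (z.2.2 < z.2.1)%N, valid z.2.2,
    ((item z.2.2).1 < z.2.1)%N, z.1.1 == (2 ^ (item z.2.2).1, 0, 0)%N,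
    z.1.2.1.1 == (item z.2.2).2.1,
    ((z.1.2.1.2.1.+1 * 2 ^ z.2.1 + z.1.2.1.2.2.+1) * (item z.2.2).2.2.2.+1
      <= (item z.2.2).2.2.1.+1 * (z.1.2.1.2.2.+1 * 2 ^ z.2.1))%N,
    small_radius z.2.1 z.1.2.2.2 & light z.2.1 z.1.2.2.1]); last first.
  by apply/funext => -[[q [b m]] [i k]].
rewrite /small_radius; computability.
- by apply: (decidable_comp cvalid); computability.
- by apply: (decidable_comp (f := fun z : A => (z.2.1, z.1.2.2.1)) decidable_light);
    computability.
Qed.

Lemma lower_semicomputable_trimmed : lower_semicomputable2 trimmed.
Proof.
rewrite /lower_semicomputable2 (_ : (fun _ => _) =
  sup_of_family R (@basic_prod R X) trimmed_family); last by apply/funext => -[x Q].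
apply: lower_semicomputable_sup_of_family semidecidable_trimmed_family => -[x Q].
have [b bx] := basic_ball_cover x.
have [s [_ sQ]] := ideal_measure_near Q (@ltr01 R).
exists (b, (s, (0, 0)%N)); split=> //=.
by rewrite /basic_mball measures_ballE /= /posrat_of /= divr1.
Qed.

Lemma rat_of_pow2 n : rat_of R (2 ^ n, 0, 0)%N = (2 ^+ n)%R.
Proof. by rewrite /rat_of /= subr0 divr1 natrX. Qed.

Lemma trim_ballE (b r : posrat_name) i :
  ((b.1.+1 * 2 ^ i + b.2.+1) * r.2.+1 <= r.1.+1 * (b.2.+1 * 2 ^ i))%N =
  (posrat_of R b + 2 ^- i <= posrat_of R r)%R.
Proof.
rewrite /posrat_of -[(2 ^- i)%R]mul1r addf_div ?expf_neq0 ?pnatr_eq0//.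
rewrite mul1r ler_pdivrMr ?mulr_gt0 ?exprn_gt0 ?ltr0n// mulrAC ler_pdivlMr ?ltr0n//.
by rewrite -natrX -!natrM -natrD -!natrM ler_nat.
Qed.

Lemma inner_level_stage_fun n i x : (n < i)%N -> inner_level n i x ->
  (2 ^+ n)%:E <= stage_fun i x.
Proof.
move=> ni xn; rewrite /stage_fun (bigD1 (Ordinal ni))//= indicE mem_set// mule1.
rewrite leeDl//; apply: sume_ge0 => k _.
by rewrite mule_ge0// lee_fin ?exprn_ge0.
Qed.

Lemma trimmed_le x Q : trimmed x Q <= 1 + limn (last_stage Q ^~ x).
Proof.
have cv := ereal_nondecreasing_is_cvgn (last_stage_mono Q x).
have lim0 : 0 <= limn (last_stage Q ^~ x).
  by apply: lime_ge => //; apply: nearW => j; exact: last_stage_ge0.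
apply: ge_ereal_sup => y [->|[q [[b m] [+ [bx mQ] ->]]]]; first by rewrite adde_ge0.
case=> [/= ->|[[i k]]].
  by rewrite (rat_of_pow2 0) expr0 leeDl.
move=> /and5P[ki vk ni /eqP-> /and4P[/eqP bk + mi li]]; rewrite trim_ballE => bi.
rewrite rat_of_pow2; apply: (@le_trans _ _ (last_stage Q i.+1 x)); last first.
  apply: (@le_trans _ _ (limn (last_stage Q ^~ x))); last by rewrite leeDr.
  by apply: lime_ge => //; exists i.+1 => // j ij; exact: (last_stage_mono Q x ij).
rewrite /= asboolT; last by exists m.
apply: inner_level_stage_fun => //; exists k; split=> //.
by move: bx; rewrite basic_ballE bk => bx; apply: lt_le_trans bi; rewrite ltrD2r.
Qed.

Lemma integral_trimmed (Q : measures X) : \int[Q]_(x in [set: borel X]) trimmed x Q <= 5%:E.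
Proof.
have mlim : @measurable_fun _ _ (borel X) (\bar R) [set: borel X]
    (fun x => limn (last_stage Q ^~ x)).
  apply: emeasurable_fun_cvg (measurable_last_stage Q) _ => x _.
  exact/ereal_nondecreasing_is_cvgn/last_stage_mono.
have lim0 x : 0 <= limn (last_stage Q ^~ x).
  apply: lime_ge; first exact/ereal_nondecreasing_is_cvgn/last_stage_mono.
  by apply: nearW => j; exact: last_stage_ge0.
apply: (@le_trans _ _ (\int[Q]_(x in [set: borel X]) (1 + limn (last_stage Q ^~ x)))).
  apply: ge0_le_integral => //.
  - by move=> x _; exact: sup_of_family_ge0.
  - exact: lower_semicomputable2_measurable lower_semicomputable_trimmed.
  - exact: emeasurable_funD.
  - by move=> x _; exact: trimmed_le.
rewrite ge0_integralD//.
rewrite (_ : 5%:E = 1 + 4%:E); last by rewrite -EFinD; congr EFin; rewrite -natr1 addrC.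
apply: leeD; first by rewrite integral_cst// mul1e; exact: probability_le1.
rewrite monotone_convergence//.
- apply: lime_le; last by apply: nearW => j; exact: integral_last_stage.
  apply: ereal_nondecreasing_is_cvgn => i j ij; apply: ge0_le_integral => //.
  + by move=> x _; exact: last_stage_ge0.
  + exact: measurable_last_stage.
  + exact: measurable_last_stage.
  + by move=> x _; exact: last_stage_mono.
- by move=> j; exact: measurable_last_stage.
- by move=> j x _; exact: last_stage_ge0.
- by move=> x _; exact: last_stage_mono.
Qed.

Lemma le_trimmed (P : measures X) x : (forall i, stage_open i P) -> f x <= 2%:E * trimmed x P.
Proof.
move=> oP; have [b0 b0x] := basic_ball_cover x.
have v1 : 1 <= trimmed x P.
  have [m [_ _ mP]] := oP 0%N; rewrite -[1]/(1%R%:E) -(expr0 2%:R) -rat_of_pow2.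
  by apply: (@sup_of_family_ub R _ _ _ _ _ (b0, m)) => //; left.
have vn n : (2 ^+ n)%:E < f x -> (2 ^+ n)%:E <= trimmed x P.
  move=> /itemP[k [vk nk]]; rewrite basic_ballE => kx.
  have : (0 < posrat_of R (item k).2.2 - mdist (ideal_point (item k).2.1) x)%R.
    by rewrite subr_gt0.
  move=> /pow2V_lt[j jlt]; pose i := maxn (maxn k.+1 n.+1) j.
  have ij : (2 ^- i <= 2 ^- j :> R)%R.
    by rewrite lef_pV2 ?posrE ?exprn_gt0// ler_eXn2l ?ltr1n// leq_maxr.
  have [m [lm sm mP]] := oP i.
  have [|r /andP[xr rk]] := @posrat_of_dense R (mdist (ideal_point (item k).2.1) x)
    (posrat_of R (item k).2.2 - 2 ^- i) (mdist_ge0 _ _); first by lra.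
  rewrite -rat_of_pow2; apply: (@sup_of_family_ub R _ _ _ _ _ (((item k).2.1, r), m)).
    right; exists (i, k); rewrite /trim_ok /= vk nk !eqxx trim_ballE lm sm /=.
    rewrite !leq_max !ltnSn/= orbT /= !andbT; lra.
  by split=> //=; rewrite basic_ballE.
rewrite leNgt; apply/negP; case: (trimmed x P) v1 vn => [r|_ _|//]; last first.
  by rewrite gt0_muley ?lte_fin// ltNge leey.
rewrite lee_fin -EFinM => r1 vn rf.
have exn : exists n, (r < 2 ^+ n)%R.
  have := archi_boundP (le_trans ler01 r1); set n := Num.bound _ => rn.
  by exists n; rewrite (lt_trans rn)// -natrX ltr_nat ltn_expl.
case: (ex_minnP exn) => -[|n] rn nmin.
  by move: rn; rewrite expr0 ltNge r1.
have nr : (2 ^+ n <= r)%R.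
  by rewrite leNgt; apply/negP => /nmin; rewrite ltnn.
have : (2 ^+ n.+1)%:E < f x.
  by apply: le_lt_trans rf; rewrite lee_fin exprS ler_pM2l.
by move=> /vn; rewrite lee_fin leNgt rn.
Qed.

End trimming.

Section comparison.
Variables (R : realType) (X : constructiveMetricType R).
Local Open Scope ereal_scope.

Lemma level_items (f : X -> \bar R) : lower_semicomputable1 f ->
  exists (item : nat -> nat * ball_name) (valid : nat -> bool),
  [/\ computable item, decidable_pred valid & forall n x, (2 ^+ n)%:E < f x <->
    exists k, [/\ valid k, (item k).1 = n & basic_ball (item k).2 x]].
Proof.
move=> [f0 [E /enumerable_semidecidable[p cp pE] fE]].
have [e ce eP] : effective ((nat * ball_name) * nat)%type.
  by repeat (apply: effective_pair || exact: effective_nat).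
exists (fun k => (e k).1),
  (fun k => p (((2 ^ (e k).1.1, 0, 0)%N, (e k).1.2), (e k).2)); split.
- by computability.
- apply: (decidable_comp (f := fun k => (((2 ^ (e k).1.1, 0, 0)%N, (e k).1.2), (e k).2)) cp).
  by computability.
move=> n x; have -> : (2 ^+ n)%:E < f x =
    [set x | (rat_of R (2 ^ n, 0, 0)%N)%:E < f x] x :> Prop by rewrite rat_of_pow2.
rewrite fE; split=> [[b /pE[w pw] bx]|[k [pk nk bx]]].
  have [k ek] := eP ((n, b), w).
  by exists k; rewrite ek; split.
by exists (e k).1.2 => //; apply/pE; exists (e k).2; rewrite /= -nk.
Qed.

Lemma class_test_le_uniform_test (C : set (measures X)) (f : X -> \bar R) :
  class_test C f -> exists2 v : X -> measures X -> \bar R, uniform_test v &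
    forall P x, C P -> f x <= 10%:E * v x P.
Proof.
move=> [lf intf]; have [item [valid [citem cvalid itemP]]] := level_items lf.
have [F' rF FE'] := @ideal_point_computable R X.
pose F (y : nat * nat * nat) := F' [tuple y.1.1; y.1.2; y.2].
have cF : computable F by apply: (computable_nat3 rF); computability.
pose v := trimmed (X := X) item valid F.
have lv : lower_semicomputable2 v.
  exact: lower_semicomputable_trimmed.
have v0 x P : 0 <= v x P by exact: lv.1 (x, P).
exists (fun x P => (5%:R^-1)%:E * v x P).
  split; first exact: lower_semicomputable_scale lv.
  move=> P; rewrite ge0_integralZl_EFin//; last exact: lower_semicomputable2_measurable.
  rewrite lee_pdivrMl// mule1.
  by apply: integral_trimmed.
move=> P x CP; rewrite muleA -EFinM (_ : (10 * 5^-1 = 2 :> R)%R); last by lra.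
apply: le_trimmed => //.
have mf := lower_semicomputable1_measurable lf.
apply: (stage_open_class lf.1 itemP FE') => //; last exact: intf.
move=> n; apply: sub_sigma_algebra.
have [_ [E _ fE]] := lf.
rewrite /level -(rat_of_pow2 R n) fE.
by apply: bigcup_open => b _; exact: open_metric_ball.
Qed.

Lemma universal_uniform_test_le (C : set (measures X)) (tC : X -> \bar R)
    (s t : X -> measures X -> \bar R) :
  effectively_compact C -> universal_class_test C tC -> test_separator C s ->
  uniform_test t ->
  exists2 c : R, (0 < c)%R & forall P x, C P -> t x P <= c%:E * maxe (tC x) (s x P).
Proof.
move=> Ceff [[ltC _] tCmax] [[ls ints] sep] [lt intt].
have [u [lu uh hu]] := lower_semicomputable_class_inf Ceff
  (h := fun x P => maxe (t x P) (s x P)) (lower_semicomputable_max lt ls).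
have mt P := lower_semicomputable2_measurable P lt.
have ms P := lower_semicomputable2_measurable P ls.
have t0 x P : 0 <= t x P := lt.1 (x, P).
have s0 x P : 0 <= s x P := ls.1 (x, P).
have [|c c0 uc] := tCmax (fun x => (2%:R^-1)%:E * u x).
  split; first exact: lower_semicomputable_scale lu.
  move=> P CP; rewrite ge0_integralZl_EFin//; last 2 first.
  - by move=> x _; exact: lu.1.
  - exact: lower_semicomputable1_measurable.
  rewrite lee_pdivrMl// mule1.
  apply: (@le_trans _ _ (\int[P]_(x in [set: borel X]) (t x P + s x P))).
    apply: ge0_le_integral => //.
    - by move=> x _; exact: lu.1.
    - exact: lower_semicomputable1_measurable.
    - exact: emeasurable_funD.
    - move=> x _; apply: le_trans (uh _ _ CP) _.
      by rewrite ge_max leeDl ?leeDr.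
  rewrite ge0_integralD// (_ : 2%:E = 1 + 1); last by rewrite -EFinD.
  exact: leeD (intt P) (ints P).
exists (2 * c)%R; first by rewrite mulr_gt0.
move=> P x CP; have [sP|sP] := eqVneq (s x P) +oo.
  by rewrite sP maxey gt0_muley ?leey// lte_fin mulr_gt0.
have tu : t x P <= u x.
  apply: hu => Q CQ; have [PQ|nPQ] := pselect (same_measure P Q).
    by rewrite (same_measure_lower_semicomputable2 x lt PQ) le_max lexx.
  have [/eqP|sQ] := sep _ _ CP CQ nPQ x; first by rewrite (negbTE sP).
  by rewrite sQ maxey leey.
apply: (le_trans tu); move: (uc x); rewrite lee_pdivrMl// muleA -EFinM => /le_trans; apply.
by rewrite lee_wpmul2l ?lee_fin ?mulr_ge0 ?(ltW c0)// le_max lexx.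
Qed.

End comparison.

Local Open Scope ereal_scope.

Theorem theorem30 (R : realType) (X : constructiveMetricType R)
    (C : set (measures X)) (tC : X -> \bar R)
    (s t : X -> measures X -> \bar R) :
  effectively_compact C ->
  universal_class_test C tC ->
  test_separator C s ->
  universal_uniform_test t ->
  effectively_orthogonal t C ->
  exists2 c : R, (0 < c)%R &
    forall (P : measures X) (x : X), C P ->
      t x P <= c%:E * maxe (tC x) (s x P) /\
      maxe (tC x) (s x P) <= c%:E * t x P.
Proof.
move=> Ceff tCuniv ssep [tt tmax] _.
have [c1 c10 tle] := universal_uniform_test_le Ceff tCuniv ssep tt.
have [v /tmax[c2 c20 vt] tCv] := class_test_le_uniform_test tCuniv.1.
have [c3 c30 st] := tmax _ ssep.1.
have t0 x P : (0 <= t x P)%E := tt.1.1 (x, P).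
have tC0 x : (0 <= tC x)%E := tCuniv.1.1.1 x.
exists (c1 + 10 * c2 + c3)%R; first by rewrite !addr_gt0 ?mulr_gt0.
move=> P x CP; split.
  apply: (le_trans (tle _ _ CP)); rewrite lee_wpmul2r ?le_max ?tC0// lee_fin.
  by rewrite -addrA lerDl addr_ge0 ?mulr_ge0 ?ltW.
rewrite ge_max; apply/andP; split.
  apply: (le_trans (tCv _ _ CP)).
  apply: (@le_trans _ _ (10%:E * (c2%:E * t x P))%E).
    by rewrite lee_wpmul2l ?lee_fin.
  rewrite muleA -EFinM lee_wpmul2r// lee_fin addrAC lerDr addr_ge0 ?ltW//.
apply: (le_trans (st _ _)); rewrite lee_wpmul2r// lee_fin lerDr.
by rewrite addr_ge0 ?mulr_ge0 ?ltW.
Qed.
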